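(* Let $Q$ be a finite quiver with vertex set $I$ and let $d,n\in\mathbf{N}I$. Then $\mathrm{H}_{d,n}(Q)$ has a cell decomposition whose cells are parametrized by $\Phi_{d,n}$. That is, there is a filtration by closed subvarieties $\mathrm{H}_{d,n}(Q)=X_0\supseteq X_1\supseteq\dots\supseteq X_s=\emptyset$ such that each $X_i\setminus X_{i+1}$ ($i=0,\dots,s-1$) is isomorphic to a disjoint union of affine spaces, and the set of all affine spaces (cells) occurring is in bijection with $\Phi_{d,n}$.
   Context: $\mathrm{H}_{d,n}(Q)$: fix complex vector spaces $M_q$ of dimension $d_q$ and $V_q$ of dimension $n_q$ with basis $(v_{q,i})_{1\le i\le n_q}$, for $q\in I$. $\mathrm{H}_{d,n}(Q)$ is the geometric quotient by $\prod_q\mathrm{GL}(M_q)$ (base change) of the open set of pairs $(M_*,f_* )$, $M_*=(M_\alpha:M_i\to M_j)_{\alpha:i\to j}$, $f_*=(f_q:V_q\to M_q)_{q\in I}$, such that the image of $f_*$ generates the representation $M_*$ (no proper subrepresentation contains it). Forests: a path $w=\alpha_1\cdots\alpha_m$ in $Q$ is a word of composable arrows, $\alpha_1$ traversed first; there is an empty path $()$ at each vertex; $t(w)$ is the terminal vertex of $w$ ($t(())=q$ for the empty path at $q$). $M_w=M_{\alpha_m}\circ\cdots\circ M_{\alpha_1}$ (identity for the empty path). $T_q$ is the tree of all paths starting in $q$, with edges $\alpha_1\cdots\alpha_m\to\alpha_1\cdots\alpha_m\alpha_{m+1}$. $\mathcal{F}_n(Q)$ consists of $n_q$ copies $T_{q,1},\dots,T_{q,n_q}$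 of $T_q$ for each $q\in I$; its vertices are triples $(q,i,w)$. A subforest $S_*=(S_{q,i})$ consists of subsets $S_{q,i}\subset T_{q,i}$ (possibly empty) closed under predecessors (initial subwords). $U_{S_*}\subset\mathrm{H}_{d,n}(Q)$ is the set of classes of $(M_*,f_* )$ such that for every $j\in I$ the elements $M_wf_q(v_{q,i})$, $(q,i,w)\in S_*$ with $t(w)=j$, form a basis of $M_j$. $\Phi_{d,n}$ is the set of all subforests $S_*$ of $\mathcal{F}_n(Q)$ such that $U_{S_*}\neq\emptyset$. *)

(* Defs.v *)
From HB Require Import structures.
From mathcomp Require Import all_boot all_order all_algebra.
From mathcomp Require Import complex.
From mathcomp Require Import boolp classical_sets functions reals topology.
From mathcomp Require Import generic_quotient mpoly.
Set Implicit Arguments.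
Unset Strict Implicit.
Unset Printing Implicit Defensive.
Import GRing.Theory.
Local Open Scope quotient_scope.
Local Open Scope classical_set_scope.
Local Open Scope ring_scope.

(** Varieties in the classical sense: spaces with functions over a field F.
    [regular U f] is meaningful for U open and says that the restriction of f
    to U is a regular function on U; the values of f outside U are irrelevant. *)
Record funSpace (F : fieldType) := FunSpace {
  carrier :> topologicalType;
  regular : set carrier -> (carrier -> F) -> Prop }.

Definition morphism (F : fieldType) (X Y : funSpace F) (f : X -> Y) : Prop :=
  continuous f /\
  forall (V : set Y) (h : Y -> F),
    open V -> regular V h -> regular (f @^-1` V) (h \o f).

Definition isomorphic (F : fieldType) (X Y : funSpace F) : Prop :=
  exists (f : X -> Y) (g : Y -> X),
    [/\ cancel f g, cancel g f, morphism f & morphism g].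

(** Affine space with coordinates indexed by a finite type K. *)
Definition affine (F : fieldType) (K : finType) : Type := {ffun K -> F}.

Section Zariski.
Variables (F : fieldType) (K : finType).
Implicit Types (p q : {mpoly F[#|K|]}) (x : affine F K).

HB.instance Definition _ := Choice.copy (affine F K) {ffun K -> F}.

Definition peval p x : F :=
  p.@[fun i : 'I_#|K| => (x : {ffun K -> F}) (enum_val i)].

(** Complements of the zero loci of arbitrary sets of polynomials. *)
Definition zariski_open (U : set (affine F K)) : Prop :=
  exists P : set ({mpoly F[#|K|]}),
    ~` U = [set x | forall p, P p -> peval p x = 0].

Lemma zariski_openP (U : set (affine F K)) :
  zariski_open U <->
  forall x, U x -> exists2 p, peval p x != 0 & [set y | peval p y != 0] `<=` U.
Proof.
split=> [[P UP] x Ux|H].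
  have : ~ (~` U) x by [].
  rewrite UP => /existsNP[p /not_implyP[Pp /eqP px]].
  exists p => // y /= /eqP py; apply: contrapT => nUy.
  have : (~` U) y by [].
  by rewrite UP => /(_ p Pp).
exists [set p | [set y | peval p y != 0] `<=` U].
apply/seteqP; split=> x /= => [nUx p pU|xP Ux].
  by apply: contrapT => /eqP /pU.
by have [p px /xP p0] := H x Ux; rewrite p0 eqxx in px.
Qed.

Let zariski_openT : zariski_open [set: affine F K].
Proof.
by apply/zariski_openP => x _; exists 1; rewrite // /peval rmorph1 oner_neq0.
Qed.

Let zariski_openI : setI_closed zariski_open.
Proof.
move=> U V /zariski_openP oU /zariski_openP oV; apply/zariski_openP => x [Ux Vx].
have [p px pU] := oU x Ux; have [q qx qV] := oV x Vx.
exists (p * q); first by rewrite /peval rmorphM mulf_neq0.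
move=> y /=; rewrite /peval rmorphM mulf_eq0 negb_or => /andP[py qy].
by split; [exact: pU | exact: qV].
Qed.

Let zariski_open_bigU (I : Type) (U : I -> set (affine F K)) :
  (forall i, zariski_open (U i)) -> zariski_open (\bigcup_i U i).
Proof.
move=> oU; apply/zariski_openP => x [i _ Uix].
have /zariski_openP/(_ x Uix)[p px pU] := oU i.
by exists p => // y /pU; exists i.
Qed.

HB.instance Definition _ := isOpenTopological.Build (affine F K)
  zariski_openT zariski_openI zariski_open_bigU.

Definition affine_space : funSpace F :=
  @FunSpace F (affine F K) (fun U f =>
    forall x, U x -> exists p q,
      peval q x != 0 /\ \forall y \near x, f y = peval p y / peval q y).

End Zariski.

(** Open and locally closed subvarieties; [set_type Z] carries the induced
    topology. *)
Definition subspace_of (F : fieldType) (X : funSpace F) (Z : set X) :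
    funSpace F :=
  @FunSpace F (set_type Z) (fun V f =>
    forall z, V z -> exists (W : set X) (g : X -> F),
      [/\ open W, W (set_val z), regular W g &
          forall y, V y -> W (set_val y) -> f y = g (set_val y)]).

Definition disjoint_union (F : fieldType) (K : choiceType)
    (X : K -> funSpace F) : funSpace F :=
  @FunSpace F {k : K & X k} (fun V f =>
    forall k, regular (existT X k @^-1` V) (f \o existT X k)).

(** The quotient has the quotient topology, and its regular functions on V are
    the regular functions on the preimage of V that are constant on classes: if
    T is a space with a group action whose orbits are the classes, this is the
    structure any geometric quotient has. *)
Definition quotient_space (F : fieldType) (T : funSpace F) (e : equiv_rel T) :
    funSpace F :=
  @FunSpace F (quotient_topology {eq_quot e}) (fun V f =>
    regular (\pi_({eq_quot e}) @^-1` V) (f \o \pi_({eq_quot e}))).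

(** [Y i] is the i-th closed subset of the filtration, [K i] indexes the cells
    of its i-th stratum, of dimensions [N]. *)
Definition has_cell_decomposition (F : fieldType) (X : funSpace F)
    (L : Type) (Phi : set L) : Prop :=
  exists (s : nat) (Y : nat -> set X)
         (K : 'I_s -> finType) (N : forall i, K i -> nat)
         (label : {i : 'I_s & K i} -> L),
    [/\ Y 0%N = setT /\ Y s = set0,
        forall i, (i <= s)%N -> closed (Y i),
        forall i, (i < s)%N -> Y i.+1 `<=` Y i,
        forall i : 'I_s,
          isomorphic (subspace_of (Y i `\` Y i.+1))
                     (disjoint_union (fun k : K i => affine_space F 'I_(N i k)))
      & set_bij setT Phi label].

Record quiver := Quiver {
  vertex :> finType;
  arrow : finType;
  src : arrow -> vertex;
  tgt : arrow -> vertex }.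

Section Paths.
Variable Q : quiver.

Inductive path_from (q : Q) : Q -> Type :=
  | empty_path : path_from q q
  | extend (a : arrow Q) : path_from q (src a) -> path_from q (tgt a).

Inductive initial_subword (q : Q) :
    forall j k : Q, path_from q j -> path_from q k -> Prop :=
  | initial_refl j (w : path_from q j) : initial_subword w w
  | initial_extend j (v : path_from q j) (a : arrow Q)
      (w : path_from q (src a)) :
      initial_subword v w -> initial_subword v (extend w).

(** The vertices (q, i, w) of the forest, stratified by t(w) = j. *)
Definition forest_vertex_at (n : Q -> nat) (j : Q) : Type :=
  {q : Q & ('I_(n q) * path_from q j)%type}.

Definition forest_vertex (n : Q -> nat) : Type :=
  {j : Q & forest_vertex_at n j}.

Definition forest_pt (n : Q -> nat) (q : Q) (i : 'I_(n q)) (j : Q)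
    (w : path_from q j) : forest_vertex n :=
  existT (forest_vertex_at n) j
    (existT (fun q => ('I_(n q) * path_from q j)%type) q (i, w)).

Definition subforest (n : Q -> nat) (S : set (forest_vertex n)) : Prop :=
  forall (q : Q) (i : 'I_(n q)) (j k : Q)
         (v : path_from q j) (w : path_from q k),
    initial_subword v w -> S (forest_pt i w) -> S (forest_pt i v).

End Paths.

Section HilbertScheme.
Variables (F : fieldType) (Q : quiver) (d n : Q -> nat).

(** The matrix entries of the pairs (M, f), where M_q = F^(d q) and
    V_q = F^(n q), with v_(q,i) the standard basis. *)
Definition coords : finType :=
  ({a : arrow Q & 'I_(d (tgt a)) * 'I_(d (src a))} +
   {q : Q & 'I_(d q) * 'I_(n q)})%type.

Definition pairs : funSpace F := affine_space F coords.

Definition arrow_mx (x : pairs) (a : arrow Q) :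
    'M[F]_(d (tgt a), d (src a)) :=
  \matrix_(i, j) (x : {ffun coords -> F})
    (inl (existT (fun a => 'I_(d (tgt a)) * 'I_(d (src a)))%type a (i, j))).

Definition frame_mx (x : pairs) (q : Q) : 'M[F]_(d q, n q) :=
  \matrix_(i, j) (x : {ffun coords -> F})
    (inr (existT (fun q => 'I_(d q) * 'I_(n q))%type q (i, j))).

Definition subrepresentation (x : pairs)
    (U : forall q : Q, {vspace 'cV[F]_(d q)}) : Prop :=
  forall (a : arrow Q) (u : 'cV[F]_(d (src a))),
    u \in U (src a) -> arrow_mx x a *m u \in U (tgt a).

Definition stable : set pairs :=
  [set x | forall U : (forall q : Q, {vspace 'cV[F]_(d q)}),
     subrepresentation x U ->
     (forall (q : Q) (v : 'cV[F]_(n q)), frame_mx x q *m v \in U q) ->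
     forall q, U q = fullv].

Definition stable_pairs : funSpace F := subspace_of stable.

Definition base_change (x y : pairs) : Prop :=
  exists g : forall q : Q, 'M[F]_(d q),
    [/\ forall q, g q \in unitmx,
        forall a,
          arrow_mx y a = g (tgt a) *m arrow_mx x a *m invmx (g (src a))
      & forall q, frame_mx y q = g q *m frame_mx x q].

Definition same_class (x y : stable_pairs) : bool :=
  `[< base_change (set_val x) (set_val y) >].

Let same_class_refl : reflexive same_class.
Proof.
move=> x; apply/asboolP; exists (fun=> 1%:M); split=> [q|a|q].
- exact: unitmx1.
- by rewrite mul1mx invmx1 mulmx1.
- by rewrite mul1mx.
Qed.

Let same_class_symm x y : same_class x y -> same_class y x.
Proof.
move=> /asboolP[g [gU ga gf]]; apply/asboolP.
exists (fun q => invmx (g q)); split=> [q|a|q].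
- by rewrite unitmx_inv.
- by rewrite ga invmxK -!mulmxA mulVmx// mulmx1 mulmxA mulVmx// mul1mx.
- by rewrite gf mulmxA mulVmx// mul1mx.
Qed.

Let same_class_sym : ssrbool.symmetric same_class.
Proof. by move=> x y; apply/idP/idP; exact: same_class_symm. Qed.

Let same_class_trans : transitive same_class.
Proof.
move=> y x z /asboolP[g [gU ga gf]] /asboolP[h [hU ha hf]]; apply/asboolP.
exists (fun q => h q *m g q); split=> [q|a|q].
- by rewrite unitmx_mul hU gU.
- have -> : invmx (h (src a) *m g (src a))
      = invmx (g (src a)) *m invmx (h (src a)).
    have u : h (src a) *m g (src a) \in unitmx by rewrite unitmx_mul hU gU.
    apply: (can_inj (mulKmx u)); rewrite mulmxV//.
    by rewrite -mulmxA (mulmxA (g _)) mulmxV// mul1mx mulmxV.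
  by rewrite ha ga !mulmxA.
- by rewrite hf gf mulmxA.
Qed.

Canonical same_class_equiv : equiv_rel stable_pairs :=
  EquivRel same_class same_class_refl same_class_sym same_class_trans.

Definition hilbert : funSpace F := quotient_space same_class_equiv.

Definition class_of (x : stable_pairs) : hilbert :=
  \pi_({eq_quot same_class_equiv}) x.

(** M_w : M_q -> M_j for a path w from q to j. *)
Fixpoint path_mx (x : pairs) (q j : Q) (w : path_from q j) :
    'M[F]_(d j, d q) :=
  match w with
  | empty_path => 1%:M
  | extend a w' => arrow_mx x a *m path_mx x w'
  end.

(** M_w (f_q (v_(q,i))) for p = (q, i, w). *)
Definition forest_vector (x : pairs) (j : Q) (p : forest_vertex_at n j) :
    'cV[F]_(d j) :=
  path_mx x (tagged p).2 *m
    (frame_mx x (tag p) *m delta_mx (tagged p).1 0).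

(** Being a basis does not depend on how the family is enumerated, and a basis
    of M_j is necessarily a finite family. *)
Definition forest_basis (S : set (forest_vertex n)) (x : pairs) : Prop :=
  forall j : Q, exists (m : nat) (e : 'I_m -> forest_vertex_at n j),
    set_bij setT [set p | S (existT (forest_vertex_at n) j p)] e /\
    basis_of (@fullv F 'cV[F]_(d j)) [seq forest_vector x (e k) | k : 'I_m].

Definition chart (S : set (forest_vertex n)) : set hilbert :=
  [set class_of x | x in [set x : stable_pairs | forest_basis S (set_val x)]].

Definition Phi : set (set (forest_vertex n)) :=
  [set S | subforest S /\ chart S !=set0].

End HilbertScheme.

Arguments hilbert F {Q} d n.
Arguments Phi F {Q} d n.

(* Main.v *)
Require Import Defs.
From mathcomp Require Import all_boot all_algebra complex reals.
From Stdlib Require Eqdep_dec.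
From mathcomp Require Import boolp classical_sets functions topology.
From mathcomp Require Import generic_quotient mpoly.
Set Implicit Arguments.
Unset Strict Implicit.
Unset Printing Implicit Defensive.
Import GRing.Theory.
Local Open Scope quotient_scope.
Local Open Scope classical_set_scope.
Local Open Scope ring_scope.

(** Order the vertices of the forest degree-lexicographically, an order that is
    preserved by appending an arrow to two paths. For a stable pair x, the vertices
    whose vectors are not in the span of the vectors of smaller vertices form a
    subforest S(x), and their vectors form bases of all M_j. If x lies in the chart of
    S, then S(x) is at most S in the lexicographic order, so for a fixed S the union
    of the loci {S(x) = S'} over all S' <= S equals the union of the charts of all S'
    <= S and is open; these unions are the complements of the filtration. Changing the
    bases of the M_j to those given by S puts a pair of the chart of S into a normal
    form whose entries are regular on the chart. There S(x) = S means exactly that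
    every minimal vertex outside S is a combination of smaller elements of S; these
    coefficients can be prescribed arbitrarily and the other entries are forced, so
    the locus {S(x) = S} is a coordinate subspace of the space of normal forms. *)


(** * Spaces with functions *)

(** [funSpace] carries no axioms; these are the ones used below. [regular_local] combines
    restriction, gluing and independence of the values outside [U]. *)
Record function_sheaf (F : fieldType) (X : funSpace F) : Prop := FunctionSheaf {
  regular_local : forall (U : set X) (f : X -> F), open U ->
    (forall x, U x -> exists (W : set X) (g : X -> F),
      [/\ open W, W x, regular W g & forall y, W y -> U y -> f y = g y]) ->
    regular U f;
  regular_cst : forall (U : set X) (c : F), open U -> regular U (fun=> c);
  regularD : forall (U : set X) (f g : X -> F), open U ->
    regular U f -> regular U g -> regular U (fun x => f x + g x);
  regularM : forall (U : set X) (f g : X -> F), open U ->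
    regular U f -> regular U g -> regular U (fun x => f x * g x);
  open_regular_neq0 : forall (U : set X) (f : X -> F), open U ->
    regular U f -> open (U `&` [set x | f x != 0]);
  regularV : forall (U : set X) (f : X -> F), open U ->
    regular U f -> regular (U `&` [set x | f x != 0]) (fun x => (f x)^-1) }.

Section FunctionSheafTheory.
Variables (F : fieldType) (X : funSpace F) (sX : function_sheaf X).
Implicit Types (U W : set X) (f g : X -> F).

Lemma regular_sub U W f : open U -> open W -> W `<=` U -> regular U f ->
  regular W f.
Proof.
move=> oU oW WU rf; apply: (regular_local sX) => // x Wx.
by exists U, f; split => //; exact: WU.
Qed.

Lemma eq_regular U f g : open U -> (forall x, U x -> f x = g x) ->
  regular U f -> regular U g.
Proof.
move=> oU fg rf; apply: (regular_local sX) => // x Ux.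
by exists U, f; split => // y Uy _; rewrite fg.
Qed.

Lemma regular_sum (I : Type) (r : seq I) (P : pred I) U (f : I -> X -> F) :
  open U -> (forall i, regular U (f i)) ->
  regular U (fun x => \sum_(i <- r | P i) f i x).
Proof.
move=> oU rf; elim: r => [|i r IHr].
  by apply: (eq_regular oU _ (regular_cst sX 0 oU)) => x _; rewrite big_nil.
case Pi: (P i); last first.
  by apply: (eq_regular oU _ IHr) => x _; rewrite big_cons Pi.
apply: (eq_regular oU _ (regularD sX oU (rf i) IHr)) => x _.
by rewrite big_cons Pi.
Qed.

Lemma regular_prod (I : Type) (r : seq I) (P : pred I) U (f : I -> X -> F) :
  open U -> (forall i, regular U (f i)) ->
  regular U (fun x => \prod_(i <- r | P i) f i x).
Proof.
move=> oU rf; elim: r => [|i r IHr].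
  by apply: (eq_regular oU _ (regular_cst sX 1 oU)) => x _; rewrite big_nil.
case Pi: (P i); last first.
  by apply: (eq_regular oU _ IHr) => x _; rewrite big_cons Pi.
apply: (eq_regular oU _ (regularM sX oU (rf i) IHr)) => x _.
by rewrite big_cons Pi.
Qed.

Lemma regularX (k : nat) U f : open U -> regular U f ->
  regular U (fun x => f x ^+ k).
Proof.
move=> oU rf; elim: k => [|k IHk].
  by apply: (eq_regular oU _ (regular_cst sX 1 oU)) => x _; rewrite expr0.
by apply: (eq_regular oU _ (regularM sX oU rf IHk)) => x _; rewrite exprS.
Qed.

Lemma regular_peval (K : finType) (p : {mpoly F[#|K|]}) U (h : X -> affine F K) :
  open U -> (forall k, regular U (fun x => (h x : {ffun K -> F}) k)) ->
  regular U (fun x => peval p (h x)).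
Proof.
move=> oU rh.
have H : regular U (fun x => \sum_(m <- msupp p)
   p@_m * \prod_i (h x : {ffun K -> F}) (enum_val i) ^+ m i).
  apply: regular_sum => // m; apply: (regularM sX) => //.
    exact: (regular_cst sX).
  by apply: regular_prod => // i; apply: regularX.
by apply: (eq_regular oU _ H) => x _; rewrite /peval mevalE.
Qed.

Definition regular_mx (m k : nat) U (A : X -> 'M[F]_(m, k)) : Prop :=
  forall i j, regular U (fun x => A x i j).

Lemma regular_mulmx (m k l : nat) U (A : X -> 'M[F]_(m, k))
    (B : X -> 'M[F]_(k, l)) : open U ->
  regular_mx U A -> regular_mx U B -> regular_mx U (fun x => A x *m B x).
Proof.
move=> oU rA rB i j.
have H : regular U (fun x => \sum_h A x i h * B x h j).
  by apply: regular_sum => // h; apply: (regularM sX).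
by apply: (eq_regular oU _ H) => x _; rewrite mxE.
Qed.

Lemma regular_det (m : nat) U (A : X -> 'M[F]_m) : open U ->
  regular_mx U A -> regular U (fun x => \det (A x)).
Proof.
move=> oU rA; apply: regular_sum => // s; apply: (regularM sX) => //.
  exact: (regular_cst sX).
exact: regular_prod.
Qed.

(** By Cramer's rule the entries are cofactors times the inverse of the determinant, which vanishes
    nowhere on [U]. *)
Lemma regular_invmx (m : nat) U (A : X -> 'M[F]_m) : open U ->
  regular_mx U A -> (forall x, U x -> A x \in unitmx) ->
  regular_mx U (fun x => invmx (A x)).
Proof.
move=> oU rA uA i j.
have rd := regular_det oU rA.
have rV : regular U (fun x => (\det (A x))^-1).
  apply: (regular_sub _ oU _ (regularV sX oU rd)).
    exact: (open_regular_neq0 sX oU rd).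
  by move=> x Ux; split=> //=; rewrite -unitfE; exact: uA.
have rc : regular U (fun x => cofactor (A x) j i).
  apply: (regularM sX) => //; first exact: (regular_cst sX).
  apply: regular_det => // i' j'.
  by apply: (eq_regular oU _ (rA (lift j i') (lift i j'))) => x _; rewrite !mxE.
apply: (eq_regular oU _ (regularM sX oU rV rc)) => x Ux.
by rewrite /invmx uA // mxE [in RHS]mxE.
Qed.

End FunctionSheafTheory.

(** * Regular functions on affine space *)

Section Affine.
Variables (F : fieldType) (K : finType).

Lemma open_peval_neq0 (p : {mpoly F[#|K|]}) :
  open ([set x | peval p x != 0] : set (affine_space F K)).
Proof. by apply/zariski_openP => x px; exists p. Qed.

Lemma regular_affineP (U : set (affine_space F K)) (f : affine_space F K -> F) :
  regular U f <-> forall x, U x -> exists W p q,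
    [/\ open W, W x, peval q x != 0 &
        forall y, W y -> f y = peval p y / peval q y].
Proof.
split=> [rf x Ux|H].
  have [p [q [qx]]] := rf x Ux; rewrite /prop_near1 nbhsE => -[W [oW Wx] WH].
  by exists W, p, q; split.
refine (_ : forall x, U x -> exists p q,
  peval q x != 0 /\ \forall y \near x, f y = peval p y / peval q y).
move=> x /H[W [p [q [oW Wx qx WH]]]]; exists p, q; split => //.
by apply: filterS WH _; exact: open_nbhs_nbhs.
Qed.

Lemma affine_function_sheaf : function_sheaf (affine_space F K).
Proof.
split.
- move=> U f oU H; apply/regular_affineP => x Ux.
  have [W [g [oW Wx /regular_affineP/(_ x Wx)]]] := H x Ux.
  move=> [V [p [q [oV Vx qx e]]]] fg.
  exists (U `&` W `&` V), p, q; split=> //.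
    by apply: openI => //; apply: openI.
  by move=> y [[Uy Wy] Vy]; rewrite fg // e.
- move=> U c oU; apply/regular_affineP => x Ux.
  exists setT, (c%:MP), 1; split=> //; first exact: openT.
    by rewrite /peval rmorph1 oner_neq0.
  by move=> y _; rewrite /peval rmorph1 divr1 mevalC.
- move=> U f g oU /regular_affineP rf /regular_affineP rg.
  apply/regular_affineP => x Ux.
  have [V [p [q [oV Vx qx e]]]] := rf x Ux.
  have [V' [p' [q' [oV' Vx' qx' e']]]] := rg x Ux.
  (* Adding fractions needs both denominators nonzero on the whole neighbourhood; multiplying them
     below does not, since division by zero gives zero. *)
  exists (V `&` V' `&` [set y | peval q y != 0] `&` [set y | peval q' y != 0]),
    (p * q' + p' * q), (q * q'); split=> //.
  + by do !apply: openI => //; exact: open_peval_neq0.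
  + by rewrite /peval rmorphM mulf_neq0.
  + move=> y [[[Vy Vy'] qy] qy']; rewrite e // e' // addf_div //.
    by rewrite /peval rmorphD !rmorphM.
- move=> U f g oU /regular_affineP rf /regular_affineP rg.
  apply/regular_affineP => x Ux.
  have [V [p [q [oV Vx qx e]]]] := rf x Ux.
  have [V' [p' [q' [oV' Vx' qx' e']]]] := rg x Ux.
  exists (V `&` V'), (p * p'), (q * q'); split=> //.
  + exact: openI.
  + by rewrite /peval rmorphM mulf_neq0.
  + by move=> y [Vy Vy']; rewrite e // e' // mulf_div /peval !rmorphM.
- move=> U f oU /regular_affineP rf.
  rewrite openE => x [Ux /= fx]; rewrite /interior nbhsE.
  have [V [p [q [oV Vx qx e]]]] := rf x Ux.
  exists (U `&` V `&` [set y | peval q y != 0] `&` [set y | peval p y != 0]).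
    split; first by do !apply: openI => //; exact: open_peval_neq0.
    split=> //=; apply: contraNneq fx => px.
    by rewrite e // px mul0r.
  move=> y [[[Uy Vy] qy] py]; split => //=.
  by rewrite e // mulf_neq0 // invr_neq0.
- move=> U f oU /regular_affineP rf.
  apply/regular_affineP => x [Ux /= fx].
  have [V [p [q [oV Vx qx e]]]] := rf x Ux.
  exists V, q, p; split => //.
    by apply: contraNneq fx => px; rewrite e // px mul0r.
  by move=> y Vy; rewrite e // invf_div.
Qed.

Lemma regular_coord (k : K) (U : set (affine_space F K)) : open U ->
  regular U (fun x => (x : {ffun K -> F}) k).
Proof.
move=> oU; apply/regular_affineP => x Ux.
exists setT, ('X_(enum_rank k)), 1; split => //; first exact: openT.
  by rewrite /peval rmorph1 oner_neq0.
by move=> y _; rewrite /peval rmorph1 divr1 mevalXU enum_rankK.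
Qed.

(** A polynomial in regular coordinates is again regular, so basic open sets pull back to
    non-vanishing loci of regular functions, and quotients of polynomials pull back to regular
    quotients. *)
Lemma morphism_to_affine (X : funSpace F) (f : X -> affine_space F K) :
  function_sheaf X ->
  (forall k, regular setT (fun x => (f x : {ffun K -> F}) k)) ->
  morphism f.
Proof.
move=> sX rf; have rp p := regular_peval sX p openT rf.
have op p : open [set x | peval p (f x) != 0].
  by rewrite -[X in open X]setTI; exact: (open_regular_neq0 sX openT (rp p)).
have cf : continuous f.
  apply/continuousP => V /zariski_openP oV.
  rewrite openE => x /oV[p px pV]; rewrite /interior nbhsE.
  by exists [set x | peval p (f x) != 0]; [split => //; exact: op|move=> y /pV].
split=> // V h oV /regular_affineP rh.
have oP (W : set (affine_space F K)) : open W -> open (f @^-1` W).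
  by move: cf => /continuousP; exact.
apply: (regular_local sX); first exact: oP.
move=> x /= Vx; have [W [p [q [oW Wx qx e]]]] := rh _ Vx.
exists (f @^-1` W `&` [set x | peval q (f x) != 0]),
  (fun x => peval p (f x) / peval q (f x)); split => //.
- by apply: openI; [exact: oP|exact: op].
- apply: (regularM sX); first by apply: openI; [exact: oP|exact: op].
    by apply: (regular_sub sX openT _ _ (rp p)) => //;
      apply: openI; [exact: oP|exact: op].
  apply: (regular_sub sX _ _ _ (regularV sX openT (rp q))).
  + exact: (open_regular_neq0 sX openT (rp q)).
  + by apply: openI; [exact: oP|exact: op].
  + by move=> y [].
- by move=> y [Wy _] _ /=; rewrite e.
Qed.

End Affine.

(** * Induced structure on subsets *)

Section Subspace.
Variables (F : fieldType) (X : funSpace F) (sX : function_sheaf X) (Z : set X).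

Lemma open_subspace_ofP (V : set (subspace_of Z)) :
  open V <-> exists2 W : set X, open W & V = set_val @^-1` W.
Proof. by split => [[W oW <-]|[W oW ->]]; exists W. Qed.

Lemma regular_set_val (W : set X) (g : X -> F) : regular W g ->
  open W -> @regular F (subspace_of Z) (set_val @^-1` W) (g \o set_val).
Proof. by move=> rg oW z Wz; exists W, g; split. Qed.

Lemma subspace_function_sheaf : function_sheaf (subspace_of Z).
Proof.
split.
- move=> U f oU H z Uz; have [W [g [/open_subspace_ofP[W' oW' ->] Wz rg fg]]] := H z Uz.
  have [V [h [oV Vz rh gh]]] := rg z Wz.
  exists (V `&` W'), h; split => //; first exact: openI.
    by apply: (regular_sub sX _ _ _ rh) => //; exact: openI.
  by move=> y Uy [Vy Wy]; rewrite fg // gh.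
- move=> U c oU z Uz; exists setT, (fun=> c); split=> //; first exact: openT.
  exact: (regular_cst sX _ openT).
- move=> U f g oU rf rg z Uz.
  have [V [h [oV Vz rh fh]]] := rf z Uz; have [V' [h' [oV' Vz' rh' gh]]] := rg z Uz.
  have oVV : open (V `&` V') by exact: openI.
  exists (V `&` V'), (fun x => h x + h' x); split => //.
    by apply: (regularD sX) => //; [apply: (regular_sub sX _ _ _ rh)|
      apply: (regular_sub sX _ _ _ rh')] => // y [].
  by move=> y Uy [Vy Vy']; rewrite fh // gh.
- move=> U f g oU rf rg z Uz.
  have [V [h [oV Vz rh fh]]] := rf z Uz; have [V' [h' [oV' Vz' rh' gh]]] := rg z Uz.
  have oVV : open (V `&` V') by exact: openI.
  exists (V `&` V'), (fun x => h x * h' x); split => //.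
    by apply: (regularM sX) => //; [apply: (regular_sub sX _ _ _ rh)|
      apply: (regular_sub sX _ _ _ rh')] => // y [].
  by move=> y Uy [Vy Vy']; rewrite fh // gh.
- move=> U f oU rf; rewrite openE => z [Uz /= fz]; rewrite /interior nbhsE.
  have [V [h [oV Vz rh fh]]] := rf z Uz.
  exists (U `&` set_val @^-1` (V `&` [set x | h x != 0])).
    split; last by split=> //; split => //=; rewrite -fh.
    apply: openI => //; apply/open_subspace_ofP.
    by exists (V `&` [set x | h x != 0]) => //; exact: (open_regular_neq0 sX).
  by move=> y [Uy [Vy /= hy]]; split => //=; rewrite fh.
- move=> U f oU rf z [Uz /= fz].
  have [V [h [oV Vz rh fh]]] := rf z Uz.
  exists (V `&` [set x | h x != 0]), (fun x => (h x)^-1); split => //.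
  + exact: (open_regular_neq0 sX).
  + by split => //=; rewrite -fh.
  + exact: (regularV sX).
  + by move=> y [Uy _] [Vy _]; rewrite fh.
Qed.

Lemma morphism_to_subspace (Y : funSpace F) (f : Y -> subspace_of Z) :
  function_sheaf Y -> @morphism F Y X (set_val \o f) -> morphism f.
Proof.
move=> sY [/continuousP cf mf].
have cf' : continuous f.
  by apply/continuousP => V /open_subspace_ofP[W oW ->]; exact: cf.
split => // V h oV rh.
have ofV : open (f @^-1` V) by move/continuousP: cf'; exact.
apply: (regular_local sY) => // y /= Vy.
have [W [g [oW Wy rg hg]]] := rh _ Vy.
exists ((set_val \o f) @^-1` W), (g \o (set_val \o f)); split => //.
- exact: cf.
- exact: mf.
- by move=> y' Wy' Vy'; exact: hg.
Qed.

End Subspace.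

Lemma morphism_comp (F : fieldType) (X Y Z : funSpace F) (f : X -> Y)
    (g : Y -> Z) : morphism f -> morphism g -> morphism (g \o f).
Proof.
move=> [cf mf] [cg mg]; split=> [|V h oV rh].
  by move=> x; apply: continuous_comp; [exact: cf|exact: cg].
apply: (mf (g @^-1` V) (h \o g)); last exact: mg.
by move/continuousP: cg; exact.
Qed.

(** * Quotient structure *)

Section Quotient.
Variables (F : fieldType) (T : funSpace F) (sT : function_sheaf T).
Variable e : equiv_rel T.

Let pi : T -> quotient_space e := \pi_({eq_quot e}).

Lemma morphism_pi : morphism pi.
Proof. by split => //; exact: pi_continuous. Qed.

Lemma open_quotientP (V : set (quotient_space e)) : open V <-> open (pi @^-1` V).
Proof. by []. Qed.

(** Openness and regularity on the quotient are by definition those of the pullbacks along [pi], so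
    each axiom is an instance of the one for [T]. *)
Lemma quotient_function_sheaf : function_sheaf (quotient_space e).
Proof.
have rE (U : set (quotient_space e)) (f : quotient_space e -> F) :
  regular U f = regular (pi @^-1` U) (f \o pi) by [].
split.
- move=> U f oU H; rewrite rE; apply: (regular_local sT) => // x Ux.
  have [W [g [oW Wx rg fg]]] := H _ Ux.
  by exists (pi @^-1` W), (g \o pi); split => // y Wy Uy; exact: fg.
- move=> U c oU; exact: (regular_cst sT).
- move=> U f g oU; exact: (regularD sT).
- move=> U f g oU; exact: (regularM sT).
- move=> U f oU; exact: (open_regular_neq0 sT).
- move=> U f oU; exact: (regularV sT).
Qed.

End Quotient.

Section SingleCell.
Variables (F : fieldType) (X : funSpace F).

Lemma isomorphic_unit_union (A : unit -> funSpace F) :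
  isomorphic X (A tt) -> isomorphic X (disjoint_union A).
Proof.
move=> [f [g [fK gK [cf mf] [cg mg]]]].
exists (fun x => existT A tt (f x)).
exists (fun y => let: existT k a := y in (match k return A k -> X with tt => g end) a).
split => //.
- by move=> [[] a]; rewrite gK.
- split.
    by move=> x; apply: (@continuous_comp _ _ _ f (existT A tt));
      [exact: cf|exact: existT_continuous].
  move=> V h oV rh; apply: (mf (existT A tt @^-1` V) (h \o existT A tt)); last exact: rh.
  by move/sigT_openP: oV; exact.
- split.
    apply/continuousP => V oV; apply/sigT_openP => -[].
    by move/continuousP : cg; exact.
  by move=> V h oV rh [] /=; exact: mg.
Qed.

(** Serves the strata whose index is not the weight of any label: they are empty and have no
    cells. *)
Lemma isomorphic_void_union (A : void -> funSpace F) :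
  function_sheaf X -> (X -> False) -> isomorphic X (disjoint_union A).
Proof.
move=> sX X0; exists (fun x => False_rect _ (X0 x)).
exists (fun y : disjoint_union A => match projT1 y with end).
have all_open (V : set X) : open V.
  have -> : V = set0 by apply/seteqP; split => // x; case: (X0 x).
  exact: open0.
split.
- by move=> x; case: (X0 x).
- by case=> -[].
- split; first by apply/continuousP.
  by move=> V h _ _; apply: (regular_local sX) => // x; case: (X0 x).
- split; last by move=> ? ? ? ? [].
  by apply/continuousP => V _; apply/sigT_openP => -[].
Qed.

End SingleCell.

(** * Stratifications with one cell in each stratum *)

Section Stratification.
Variables (F : fieldType) (X : funSpace F) (sX : function_sheaf X).
Variables (L : Type) (Phi : set L) (wt : L -> nat) (s : nat).
Variables (U : L -> set X) (cell : X -> L).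
Hypothesis wt_lt : forall l, Phi l -> (wt l < s)%N.
Hypothesis wt_inj : forall l l', Phi l -> Phi l' -> wt l = wt l' -> l = l'.
Hypothesis U_open : forall l, Phi l -> open (U l).
Hypothesis cellP : forall x, Phi (cell x) /\ U (cell x) x.
Hypothesis cell_min : forall l x, Phi l -> U l x -> (wt (cell x) <= wt l)%N.
Hypothesis cell_affine : forall l, Phi l -> exists N : nat,
  isomorphic (subspace_of [set x | cell x = l]) (affine_space F 'I_N).

Let Y (i : nat) : set X := [set x | (i <= wt (cell x))%N].

(** A point of [U l] has a cell of weight at most [wt l] by [cell_min], and every point lies in the
    open set of its own cell. Hence the complement of [Y i] is the union of the open sets [U l] of
    weight below [i]. *)
Let Y_closed i : closed (Y i).
Proof.
have -> : Y i = ~` (\bigcup_(l in [set l | Phi l /\ (wt l < i)%N]) U l).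
  apply/seteqP; split => [x /= ix [l [Pl li] /(cell_min Pl)]|x /= nx].
    by move=> /leq_ltn_trans /(_ li); rewrite ltnNge ix.
  rewrite /Y /= leqNgt; apply/negP => lt; apply: nx.
  by exists (cell x) => //=; [split => //|]; have [] := cellP x.
by apply: open_closedC; apply: bigcup_open => l [Pl _]; exact: U_open.
Qed.

Let Y_strata i : Y i `\` Y i.+1 = [set x | wt (cell x) = i].
Proof.
apply/seteqP; split => [x [/= ix /negP]|x /= <-].
  by rewrite -ltnNge ltnS => xi; apply/eqP; rewrite eqn_leq xi ix.
by split=> /=; rewrite /Y /= ?leqnn ?ltnn.
Qed.

(** Index type, dimensions and labels of the cells of one stratum, bundled so that a single use of
    [choice] selects all three. *)
Definition stratum_data : Type :=
  {K : finType & ((K -> nat) * (K -> L))%type}.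

(** Since [wt] is injective on [Phi], at most one label has weight [i], so the stratum is a single
    cell or empty. *)
Let stratum (i : nat) : exists D : stratum_data,
  [/\ isomorphic (subspace_of (Y i `\` Y i.+1))
        (disjoint_union (fun k => affine_space F 'I_((tagged D).1 k))),
      forall k, Phi ((tagged D).2 k) /\ wt ((tagged D).2 k) = i,
      injective (tagged D).2 &
      forall l, Phi l -> wt l = i -> exists k, (tagged D).2 k = l].
Proof.
rewrite Y_strata; have [[l [Pl li]]|nol] := pselect (exists l, Phi l /\ wt l = i).
  have [N iso] := cell_affine Pl.
  exists (existT (fun K : finType => ((K -> nat) * (K -> L))%type)
           unit (fun=> N, fun=> l)); split=> //=.
  - have -> : [set x | wt (cell x) = i] = [set x | cell x = l].
      apply/seteqP; split => x /= => [xi|-> //].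
      by apply: wt_inj; rewrite ?xi //; have [] := cellP x.
    exact: isomorphic_unit_union.
  - by case=> -[].
  - by move=> l' Pl' l'i; exists tt; apply: wt_inj; rewrite // l'i.
exists (existT (fun K : finType => ((K -> nat) * (K -> L))%type)
  void (fun=> 0%N, fun v : void => match v with end)); split => //=; first last.
- by move=> l Pl li; case: nol; exists l.
apply: isomorphic_void_union; first exact: subspace_function_sheaf.
by case=> x /set_mem /= xi; apply: nol; exists (cell x); have [] := cellP x.
Qed.

Lemma cell_decomposition_of_cover : has_cell_decomposition X Phi.
Proof.
have [D HD] := choice (fun i : 'I_s => stratum i).
exists s, Y, (fun i => tag (D i)), (fun i => (tagged (D i)).1),
  (fun ik => (tagged (D (tag ik))).2 (tagged ik)); split.
- split; apply/seteqP; split => x //= sx.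
  by have [/wt_lt] := cellP x; rewrite ltnNge sx.
- by move=> i _; exact: Y_closed.
- by move=> i _ x; exact: ltnW.
- by move=> i; have [] := HD i.
- split.
  + by move=> [i k] _ /=; have [_ /(_ k) []] := HD i.
  + move=> [i k] [i' k'] _ _ /= e; have [_ /(_ k) [_ wi] _ _] := HD i.
    have [_ /(_ k') [_ wi'] _ _] := HD i'.
    (* The weight of a label is the index of its stratum, so equal labels lie in the same
       stratum. *)
    have ii' : i = i' by apply: val_inj; rewrite -[LHS]wi -[RHS]wi' e.
    rewrite -{}ii' in k' e wi' *; have [_ _ inj _] := HD i.
    by rewrite (inj _ _ e).
  + move=> l Pl; have [_ _ _ /(_ l Pl erefl) [k kl]] := HD (Ordinal (wt_lt Pl)).
    by exists (existT _ (Ordinal (wt_lt Pl)) k).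
Qed.

End Stratification.

(* A binary numeral with the negations of A 0, A 1, ... as its digits: at the first place
   where two sets differ, the set containing that element is the lighter one. *)
Fixpoint lexweight (A : pred nat) (N : nat) : nat :=
  if N is k.+1 then ((lexweight A k).*2 + ~~ A k)%N else 0%N.

Lemma lexweight_lt A N : (lexweight A N < 2 ^ N)%N.
Proof.
elim: N => //= N IHN; rewrite expnS mul2n.
apply: (@leq_trans (lexweight A N).+1.*2); last by rewrite leq_double.
by rewrite doubleS; case: (A N); rewrite ?addn0 ?addn1 ltnS ?leqnSn.
Qed.

(** The parity of the numeral gives its last digit; halving then gives the earlier ones. *)
Lemma lexweight_inj (A B : pred nat) N : lexweight A N = lexweight B N ->
  forall k, (k < N)%N -> A k = B k.
Proof.
elim: N => //= N IHN e.
have eN : A N = B N.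
  by move: (congr1 odd e); rewrite !oddD !odd_double /= !oddb => /negb_inj.
have /IHN IH : lexweight A N = lexweight B N.
  by move: e; rewrite eN => /addIn /double_inj.
by move=> k; rewrite ltnS leq_eqVlt => /predU1P[->//|/IH].
Qed.

Lemma eq_lexweight (A B : pred nat) N : (forall k, (k < N)%N -> A k = B k) ->
  lexweight A N = lexweight B N.
Proof.
by elim: N => //= N IHN e; rewrite IHN ?e // => k kN; apply: e; exact: ltnW.
Qed.

Lemma ltn_lexweight (A B : pred nat) N k : (k < N)%N ->
  (forall i, (i < k)%N -> A i = B i) -> A k -> ~~ B k -> (lexweight A N < lexweight B N)%N.
Proof.
move=> kN e Ak Bk; elim: N kN => // N IHN; rewrite ltnS leq_eqVlt.
move=> /predU1P[<-|/IHN lt] /=.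
  by rewrite (eq_lexweight e) Ak Bk addn0 addn1.
(* If a < b then 2a + 1 < 2(a + 1) <= 2b, so later digits cannot reverse the comparison. *)
apply: (@leq_trans (lexweight A N).+1.*2); last first.
  by apply: leq_trans (leq_addr _ _); rewrite leq_double.
by rewrite doubleS; case: (A N); rewrite ?addn0 ?addn1 ltnS ?leqnSn.
Qed.

(** At the first difference the hypothesis excludes the case where only [B] contains [k], so [A] is
    the lighter set there; without a difference the weights agree. *)
Lemma leq_lexweight (A B : pred nat) N :
  (forall k, (k < N)%N -> (forall i, (i < k)%N -> A i = B i) -> B k -> A k) ->
  (lexweight A N <= lexweight B N)%N.
Proof.
move=> H; have [[k [kN [e ne]]]|no] :=
  pselect (exists k, (k < N)%N /\ (forall i, (i < k)%N -> A i = B i) /\ A k <> B k).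
  suff /andP[Ak Bk] : A k && ~~ B k by exact/ltnW/(ltn_lexweight kN e).
  move: ne (H k kN e); case: (A k); case: (B k) => //= ne h;
    by [case: ne | exact: h].
suff e k : (k < N)%N -> A k = B k by rewrite (eq_lexweight e).
elim/ltn_ind: k => k IHk kN; apply: contrapT => ne; apply: no.
by exists k; split => //; split => // i ik; apply: IHk => //; exact: ltn_trans ik kN.
Qed.

(** * Greedy bases *)

Section Greedy.
Variables (F : fieldType) (V : vectType F).
Implicit Types (u : nat -> V) (B : pred nat) (k N : nat).

Definition prefix_span u k : {vspace V} := <<[seq u i | i <- iota 0 k]>>%VS.

(** These are the pivot positions of Gaussian elimination applied to the sequence [u]. *)
Definition greedy u k : bool := u k \notin prefix_span u k.

Lemma iota0S k : iota 0 k.+1 = rcons (iota 0 k) k.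
Proof. by rewrite -addn1 iotaD cats1. Qed.

Lemma span_rcons (X : seq V) v : <<rcons X v>>%VS = (<<X>> + <[v]>)%VS.
Proof. by rewrite -cats1 span_cat span_seq1. Qed.

Lemma mem_prefix_span u k i : (i < k)%N -> u i \in prefix_span u k.
Proof. by move=> ik; apply/memv_span/map_f; rewrite mem_iota. Qed.

Lemma prefix_spanP u k (W : {vspace V}) :
  (forall i, (i < k)%N -> u i \in W) -> (prefix_span u k <= W)%VS.
Proof.
move=> H; rewrite /prefix_span; apply/span_subvP => _ /mapP[i + ->].
by rewrite mem_iota => /= ik; exact: H.
Qed.

Lemma prefix_span_mono u k l : (k <= l)%N -> (prefix_span u k <= prefix_span u l)%VS.
Proof.
by move=> kl; apply: prefix_spanP => i ik; apply/mem_prefix_span/(leq_trans ik).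
Qed.

Lemma span_greedy u k :
  <<[seq u i | i <- iota 0 k & greedy u i]>>%VS = prefix_span u k.
Proof.
elim: k => [//|k IHk]; rewrite /prefix_span iota0S filter_rcons map_rcons span_rcons.
case: ifP => [_|/negbFE uk]; first by rewrite map_rcons span_rcons IHk.
by rewrite IHk; apply/esym/addv_idPl; rewrite -memvE.
Qed.

Lemma free_rcons (X : seq V) v : free (rcons X v) = (v \notin <<X>>%VS) && free X.
Proof. by rewrite -free_cons; apply/perm_free; rewrite perm_rcons. Qed.

Lemma free_greedy u k : free [seq u i | i <- iota 0 k & greedy u i].
Proof.
elim: k => [|k IHk]; first exact: nil_free.
rewrite iota0S filter_rcons; case: ifP => // gk.
by rewrite map_rcons free_rcons span_greedy IHk andbT.
Qed.

(** Before [k] the vectors chosen by [B] are the greedy ones, so they span the whole prefix;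
    freeness of the family of [B] keeps [u k] out of that span. *)
Lemma greedy_of_free u B N k : free [seq u i | i <- iota 0 N & B i] ->
  (k < N)%N -> (forall i, (i < k)%N -> greedy u i = B i) -> B k -> greedy u k.
Proof.
move=> fB kN e Bk; move: fB.
rewrite -(subnKC kN) iotaD filter_cat map_cat => /catl_free.
rewrite iota0S filter_rcons Bk map_rcons free_rcons => /andP[+ _].
rewrite /greedy -span_greedy; congr (_ \notin <<map _ _>>%VS).
by apply/eq_in_filter => i; rewrite mem_iota => /= /e.
Qed.

(** The dimensions of the prefix spans are bounded; where they reach their maximum the spans stop
    growing. *)
Lemma prefix_span_stationary u : exists K, forall k, u k \in prefix_span u K.
Proof.
pose P m := `[< exists k, \dim (prefix_span u k) = m >].
have exP : exists m, P m by exists (\dim (prefix_span u 0)); apply/asboolP; exists 0%N.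
have ubP m : P m -> (m <= \dim (@fullv F V))%N.
  by move=> /asboolP[k <-]; apply: dimvS; exact: subvf.
have [m /asboolP[K Km] maxK] := ex_maxnP exP ubP.
exists K => k; have [kK|Kk] := ltnP k K; first exact: mem_prefix_span.
suff -> : prefix_span u K = prefix_span u k.+1 by exact: mem_prefix_span.
apply/eqP; rewrite eqEdim prefix_span_mono ?leqW //= Km; apply: maxK.
by apply/asboolP; exists k.+1.
Qed.

End Greedy.

Lemma mulmx_prefix_span (F : fieldType) (m l : nat) (M : 'M[F]_(m, l))
    (u : nat -> 'cV[F]_l) (k : nat) (v : 'cV[F]_l) (W : {vspace 'cV[F]_m}) :
  (forall i, (i < k)%N -> M *m u i \in W) -> v \in prefix_span u k -> M *m v \in W.
Proof.
move=> H; suff /subvP /[apply] : (prefix_span u k <= linfun (mulmx M) @^-1: W)%VS.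
  by rewrite -memv_preim lfunE.
by apply: prefix_spanP => i /H; rewrite -memv_preim lfunE.
Qed.

Lemma basis_of_cols (F : fieldType) (m : nat) (c : 'I_m -> 'cV[F]_m) :
  basis_of fullv [seq c k | k : 'I_m] = ((\matrix_(r, k) c k r 0) \in unitmx).
Proof.
set A := \matrix_(r, k) _.
have szc : size [seq c k | k : 'I_m] = m by rewrite size_map size_enum_ord.
have AE (a : 'cV[F]_m) : A *m a = \sum_k a k 0 *: c k.
  apply/matrixP => r z; rewrite mxE summxE (ord1 z); apply: eq_bigr => k _.
  by rewrite !mxE mulrC.
apply/idP/idP => [/andP[/eqP sc _]|uA].
  (* The solutions of these systems are the columns of a right inverse of [A]. *)
  have H i : exists a : 'cV_m, A *m a = delta_mx i 0.
    have : delta_mx i 0 \in <<[tuple c k | k < m]>>%VS.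
      by rewrite -[X in <<X>>%VS]/[seq c k | k : 'I_m] sc memvf.
    move=> /coord_span e; exists (\col_k coord [tuple c k | k < m] k (delta_mx i 0)).
    by rewrite AE; apply: etrans (esym e); apply: eq_bigr => k _;
      rewrite mxE -tnth_nth tnth_mktuple.
  have [a Ha] := choice H.
  suff /mulmx1_unit[] : A *m (\matrix_(r, i) a i r 0) = 1%:M by [].
  apply/matrixP => r i; rewrite [RHS]mxE.
  have /matrixP/(_ r 0) := Ha i; rewrite [RHS]mxE eqxx andbT => <-.
  by rewrite !mxE; apply: eq_bigr => k _; rewrite !mxE.
rewrite basisEdim szc dimvf /dim /= muln1 leqnn andbT.
apply/subvP => v _; rewrite -(mulKVmx uA v) AE; apply: memv_suml => k _.
by apply/memvZ/memv_span/map_f; rewrite mem_enum.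
Qed.

(** * The forest *)

Section ForestCodes.
Variables (Q : quiver) (n : Q -> nat).

Definition root_vertex (q : Q) (i : 'I_(n q)) : forest_vertex_at n q :=
  existT (fun q' => ('I_(n q') * path_from q' q)%type) q (i, empty_path q).

Definition child_vertex (a : arrow Q) (p : forest_vertex_at n (src a)) :
    forest_vertex_at n (tgt a) :=
  existT (fun q => ('I_(n q) * path_from q (tgt a))%type) (tag p)
    ((tagged p).1, extend (tagged p).2).

(** Induction over roots and children, so that later proofs need not open the dependent pair of root
    and path. *)
Lemma forest_ind (P : forall j, forest_vertex_at n j -> Prop) :
  (forall q (i : 'I_(n q)), P q (root_vertex i)) ->
  (forall a (p : forest_vertex_at n (src a)), P (src a) p ->
     P (tgt a) (child_vertex p)) ->
  forall j p, P j p.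
Proof.
move=> P0 P1 j [q [i w]]; elim: w => [|a w IHw]; first exact: P0.
exact: P1 IHw.
Qed.

Lemma subforestP (S : set (forest_vertex n)) : subforest S <->
  forall (a : arrow Q) (p : forest_vertex_at n (src a)),
    S (existT _ (tgt a) (child_vertex p)) -> S (existT _ (src a) p).
Proof.
split=> [sS a [q [i w]]|H q i j k v w].
  by apply: (sS q i); apply: initial_extend; exact: initial_refl.
by elim=> // j' v' a w' _ IHw Sw; apply: IHw; exact: (H a (existT _ q (i, w'))).
Qed.

(** The successor leaves room for digits that start at 1: arrow digits and root digits both stay
    below the base. *)
Definition code_base : nat := (#|arrow Q| + #|{: {q : Q & 'I_(n q)}}|).+1.

Fixpoint path_code (r : nat) (q j : Q) (w : path_from q j) : nat :=
  match w with
  | empty_path => r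
  | extend a w' => (path_code r w' * code_base + (enum_rank a).+1)%N
  end.

Definition root_code (q : Q) (i : 'I_(n q)) : nat :=
  (enum_rank (existT (fun q => 'I_(n q)) q i)).+1.

(* The arrows of a path are the digits, none of them zero, of a numeral in base
   [code_base] whose first digit is the root of the tree; so the order of the codes is
   the degree-lexicographic order of paths. *)
Definition code (j : Q) (p : forest_vertex_at n j) : nat :=
  path_code (root_code (tagged p).1) (tagged p).2.

Lemma code_child (a : arrow Q) (p : forest_vertex_at n (src a)) :
  code (child_vertex p) = (code p * code_base + (enum_rank a).+1)%N.
Proof. by []. Qed.

Lemma root_code_lt (q : Q) (i : 'I_(n q)) : (root_code i < code_base)%N.
Proof. by rewrite ltnS (leq_trans (ltn_ord _)) // leq_addl. Qed.

Lemma arrow_code_lt (a : arrow Q) : ((enum_rank a).+1 < code_base)%N.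
Proof. by rewrite ltnS (leq_trans (ltn_ord _)) // leq_addr. Qed.

Lemma code_gt0 (j : Q) (p : forest_vertex_at n j) : (0 < code p)%N.
Proof. by elim/forest_ind: j / p => // a p _; rewrite code_child addnS. Qed.

Lemma code_base_gt1 (j : Q) (p : forest_vertex_at n j) : (1 < code_base)%N.
Proof. by case: p => q [i _]; exact: leq_trans (root_code_lt i). Qed.

Lemma code_child_div (a : arrow Q) (p : forest_vertex_at n (src a)) :
  (code (child_vertex p) %/ code_base)%N = code p.
Proof. by rewrite code_child divnMDl // (divn_small (arrow_code_lt a)) addn0. Qed.

Lemma code_child_mod (a : arrow Q) (p : forest_vertex_at n (src a)) :
  (code (child_vertex p) %% code_base)%N = (enum_rank a).+1.
Proof. by rewrite code_child modnMDl (modn_small (arrow_code_lt a)). Qed.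

Lemma leq_code_base_child (a : arrow Q) (p : forest_vertex_at n (src a)) :
  (code_base <= code (child_vertex p))%N.
Proof. by rewrite code_child (leq_trans _ (leq_addr _ _)) // leq_pmull // code_gt0. Qed.

(** A difference of at least 1 in the parents' codes contributes a full [code_base], which outweighs
    any last digit, whichever arrows are appended. *)
Lemma code_child_mono (a a' : arrow Q) (p : forest_vertex_at n (src a))
    (p' : forest_vertex_at n (src a')) : (code p < code p')%N ->
  (code (child_vertex p) < code (child_vertex p'))%N.
Proof.
move=> lt; rewrite !code_child; apply: leq_trans (leq_addr _ _).
apply: (@leq_trans ((code p).+1 * code_base)%N); last by rewrite leq_mul2r lt orbT.
by rewrite mulSn addnC ltn_add2r arrow_code_lt.
Qed.

(** Roots have codes below [code_base] and children do not, so the two kinds never collide. For a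
    child the remainder modulo [code_base] recovers the arrow and the quotient recovers the
    parent. *)
Lemma code_inj_total (j j' : Q) (p : forest_vertex_at n j)
    (p' : forest_vertex_at n j') : code p = code p' ->
  existT (forest_vertex_at n) j p = existT (forest_vertex_at n) j' p'.
Proof.
elim/forest_ind: j / p j' p' => [q i|a p IHp] j' p'.
  elim/forest_ind: j' / p' => [q' i' [e]|a p' _ e]; last first.
    by have := leq_code_base_child p'; rewrite -e leqNgt root_code_lt.
  have /enum_rank_inj e' : enum_rank (existT (fun q => 'I_(n q)) q i) =
    enum_rank (existT (fun q => 'I_(n q)) q' i') by exact: val_inj.
  exact: (congr1 (fun s : {q & 'I_(n q)} =>
    existT (forest_vertex_at n) (tag s) (root_vertex (tagged s))) e').
elim/forest_ind: j' / p' => [q' i' e|a' p' _ e].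
  by have := leq_code_base_child p; rewrite e leqNgt root_code_lt.
have aa' : a = a'.
  apply/enum_rank_inj/val_inj; apply: succn_inj.
  by rewrite -(code_child_mod p) e code_child_mod.
subst a'; have /IHp e' : code p = code p' by rewrite -code_child_div e code_child_div.
by rewrite (@Eqdep_dec.inj_pair2_eq_dec _ (@eq_comparable Q) _ _ _ _ e').
Qed.

Lemma code_inj (j : Q) : injective (@code j).
Proof.
move=> p p' /code_inj_total e.
exact: (@Eqdep_dec.inj_pair2_eq_dec _ (@eq_comparable Q) _ _ _ _ e).
Qed.

(** This set, over all end points, determines the weight of [S]; [code_set_at] below selects the
    family that has to be a basis at one end point. *)
Definition code_set (S : set (forest_vertex n)) (k : nat) : bool :=
  `[< exists j (p : forest_vertex_at n j), S (existT _ j p) /\ code p = k >].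

Definition code_set_at (S : set (forest_vertex n)) (j : Q) (k : nat) : bool :=
  `[< exists p : forest_vertex_at n j, S (existT _ j p) /\ code p = k >].

Lemma code_setE (S : set (forest_vertex n)) (j : Q) (p : forest_vertex_at n j) :
  code_set S (code p) = `[< S (existT _ j p) >].
Proof.
apply/asboolP/asboolP => [[j' [p' [Sp' /code_inj_total <-]]]//|Sp].
by exists j, p.
Qed.

Lemma code_set_atE (S : set (forest_vertex n)) (j : Q) (p : forest_vertex_at n j) :
  code_set_at S j (code p) = `[< S (existT _ j p) >].
Proof.
by apply/asboolP/asboolP => [[p' [Sp' /code_inj <-]]//|Sp]; exists p.
Qed.

(** A code that is at least [code_base] belongs to a child, and division by the base passes to its
    parent. *)
Lemma code_set_divn (S : set (forest_vertex n)) (k : nat) : subforest S ->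
  code_set S k -> (code_base <= k)%N -> code_set S (k %/ code_base).
Proof.
move=> /subforestP sS /asboolP[j [p]]; elim/forest_ind: j / p => [q i|a p _] [Sp <-].
  by rewrite leqNgt root_code_lt.
by move=> _; rewrite code_child_div code_setE; apply/asboolP; exact: sS.
Qed.

End ForestCodes.

(** * Forest vectors and the greedy subforest of a pair *)

Section ForestVectors.
Variables (F : fieldType) (Q : quiver) (d n : Q -> nat).
Implicit Types (x y : pairs F d n) (S : set (forest_vertex n)).

(** Arranges the forest vectors at [j] in a sequence for greedy selection. Numbers that are not
    codes at [j] get the vector 0, which is never greedy and leaves all spans unchanged. *)
Definition coded_vector x (j : Q) (k : nat) : 'cV[F]_(d j) :=
  if pselect (exists p : forest_vertex_at n j, code p = k) is left ex
  then forest_vector x (projT1 (cid ex)) else 0.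

Lemma coded_vectorE x j (p : forest_vertex_at n j) :
  coded_vector x j (code p) = forest_vector x p.
Proof.
rewrite /coded_vector; case: pselect => [ex|[]]; last by exists p.
by case: (cid ex) => p' /= /code_inj ->.
Qed.

Lemma coded_vector_notin x j k :
  ~ (exists p : forest_vertex_at n j, code p = k) -> coded_vector x j k = 0.
Proof. by rewrite /coded_vector; case: pselect. Qed.

Lemma forest_vector_child x (a : arrow Q) (p : forest_vertex_at n (src a)) :
  forest_vector x (child_vertex p) = arrow_mx x a *m forest_vector x p.
Proof. by rewrite /forest_vector /= -mulmxA. Qed.

Lemma forest_vector_root x (q : Q) (i : 'I_(n q)) :
  forest_vector x (root_vertex i) = frame_mx x q *m delta_mx i 0.
Proof. by rewrite /forest_vector /= mul1mx. Qed.

(** The subforest S(x) of the overview; each vertex competes only with vertices having the same end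
    point. *)
Definition greedy_forest x : set (forest_vertex n) :=
  [set p : forest_vertex n |
    greedy (coded_vector x (projT1 p)) (code (projT2 p))].

(** Two pairs are allowed so that [M] can be an arrow of one pair or a base change between two. *)
Lemma mulmx_coded_span x y (j j' : Q) (M : 'M[F]_(d j', d j)) k l v :
  (forall p : forest_vertex_at n j, (code p < k)%N ->
     M *m forest_vector x p \in prefix_span (coded_vector y j') l) ->
  v \in prefix_span (coded_vector x j) k ->
  M *m v \in prefix_span (coded_vector y j') l.
Proof.
move=> H; apply: mulmx_prefix_span => i ik.
have [[p pi]|nop] := pselect (exists p : forest_vertex_at n j, code p = i).
  by rewrite -pi coded_vectorE; apply: H; rewrite pi.
by rewrite coded_vector_notin // mulmx0 mem0v.
Qed.

Lemma greedy_forestN x j (p : forest_vertex_at n j) :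
  ~ greedy_forest x (existT _ j p) <->
  forest_vector x p \in prefix_span (coded_vector x j) (code p).
Proof.
rewrite /greedy_forest /= /greedy coded_vectorE.
by split=> [/negP/negPn|->].
Qed.

(** If the vector of [p] is a combination of vectors of smaller vertices, applying the arrow writes
    the vector of the child through children that are still smaller, by [code_child_mono]. *)
Lemma greedy_subforest x : subforest (greedy_forest x).
Proof.
apply/subforestP => a p; apply: contraPP => /greedy_forestN np.
apply/greedy_forestN; rewrite forest_vector_child.
apply: mulmx_coded_span np => p' p'p; rewrite -forest_vector_child -coded_vectorE.
exact/mem_prefix_span/code_child_mono.
Qed.

Lemma base_change_vector x y (g : forall q, 'M[F]_(d q)) :
  (forall q, g q \in unitmx) ->
  (forall a, arrow_mx y a = g (tgt a) *m arrow_mx x a *m invmx (g (src a))) ->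
  (forall q, frame_mx y q = g q *m frame_mx x q) ->
  forall j (p : forest_vertex_at n j), forest_vector y p = g j *m forest_vector x p.
Proof.
move=> gU ga gf j p; elim/forest_ind: j / p => [q i|a p IHp].
  by rewrite !forest_vector_root gf mulmxA.
by rewrite !forest_vector_child IHp ga -!mulmxA (mulKmx (gU _)).
Qed.

(** Linear relations among the vectors of [x] carry over to those of [y]. Used for a base change and
    for its inverse, this makes the greedy subforest an invariant of the class. *)
Lemma greedy_forest_sub x y (g : forall q, 'M[F]_(d q)) :
  (forall j (p : forest_vertex_at n j), forest_vector y p = g j *m forest_vector x p) ->
  greedy_forest y `<=` greedy_forest x.
Proof.
move=> H [j p]; apply: contraPP => /greedy_forestN np; apply/greedy_forestN.
rewrite H; apply: mulmx_coded_span np => p' p'p; rewrite -H -coded_vectorE.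
exact/mem_prefix_span.
Qed.

Lemma base_change_greedy x y : base_change x y -> greedy_forest x = greedy_forest y.
Proof.
move=> [g [gU ga gf]]; have H := base_change_vector gU ga gf.
apply/seteqP; split; last exact: (greedy_forest_sub H).
by apply: (@greedy_forest_sub _ _ (fun q => invmx (g q))) => j p; rewrite H mulKmx.
Qed.

Lemma forest_vector_mem x (U : forall q : Q, {vspace 'cV[F]_(d q)}) :
  subrepresentation x U ->
  (forall (q : Q) (v : 'cV[F]_(n q)), frame_mx x q *m v \in U q) ->
  forall j (p : forest_vertex_at n j), forest_vector x p \in U j.
Proof.
move=> sU fU j p; elim/forest_ind: j / p => [q i|a p IHp].
  by rewrite forest_vector_root.
by rewrite forest_vector_child; exact: sU.
Qed.

Lemma forest_basis_stable S x : forest_basis S x -> stable x.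
Proof.
move=> bS U sU fU q; have [m [e [_ /andP[/eqP sp _]]]] := bS q.
apply: subv_anti; rewrite subvf /= -sp; apply/span_subvP => _ /mapP[k _ ->].
exact: forest_vector_mem.
Qed.

(** The stationary spans form a subrepresentation containing the image of the framing, so stability
    makes them full. *)
Lemma stable_span x : stable x -> forall j, exists K,
  prefix_span (coded_vector x j) K = fullv.
Proof.
move=> st; have [K HK] := choice (fun j => prefix_span_stationary (coded_vector x j)).
move=> j; exists (K j); move: j; apply: st => [a u|q v].
- apply: mulmx_coded_span => p _.
  by rewrite -forest_vector_child -coded_vectorE; exact: HK.
- have -> : v = \sum_i v i 0 *: delta_mx i 0.
    apply/matrixP => r z; rewrite (ord1 z) summxE (bigD1 r) //= !mxE !eqxx mulr1.
    by rewrite big1 ?addr0 // => i ir; rewrite !mxE eq_sym (negPf ir) mulr0.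
  rewrite mulmx_sumr; apply: memv_suml => i _; rewrite -scalemxAr.
  by apply: memvZ; rewrite -forest_vector_root -coded_vectorE; exact: HK.
Qed.

Lemma greedy_forest_basis x : stable x -> forest_basis (greedy_forest x) x.
Proof.
move=> st j; have [K HK] := stable_span st j.
set u := coded_vector x j.
pose s := [seq k <- iota 0 K | greedy u k].
(* A greedy index must be a code, because all other indices carry the zero vector. *)
have /choice[c Hc] : forall k : 'I_(size s),
    exists p : forest_vertex_at n j, code p = nth 0%N s k.
  move=> k; apply: contrapT => no.
  have : nth 0%N s k \in s by rewrite mem_nth.
  by rewrite mem_filter /greedy /u coded_vector_notin // mem0v.
have us : uniq s by rewrite filter_uniq // iota_uniq.
exists (size s), c; split; first split.
- move=> k _ /=; rewrite /greedy_forest /= Hc.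
  by have : nth 0%N s k \in s by [rewrite mem_nth]; rewrite mem_filter => /andP[].
- move=> k l _ _ kl; apply/val_inj; move/eqP: (congr1 (@code _ _ _) kl).
  by rewrite !Hc nth_uniq // => /eqP.
- move=> p /= gp; have ps : code p \in s.
    rewrite mem_filter gp mem_iota /= add0n ltnNge; apply/negP => Kp.
    move: gp; rewrite /greedy_forest /= /greedy => /negP; apply.
    by apply: (subvP (prefix_span_mono _ Kp)); rewrite HK memvf.
  have lt : (index (code p) s < size s)%N by rewrite index_mem.
  by exists (Ordinal lt) => //; apply: code_inj; rewrite Hc nth_index.
have -> : [seq forest_vector x (c k) | k : 'I_(size s)] = [seq u k | k <- s].
  rewrite -[in RHS](mkseq_nth 0%N s) /mkseq -map_comp -val_enum_ord -map_comp.
  by apply: eq_map => k /=; rewrite -Hc /u coded_vectorE.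
by rewrite /basis_of free_greedy span_greedy HK eqxx.
Qed.

(** [forest_basis] leaves the enumeration open; this compares any enumeration with the one by
    increasing codes. *)
Lemma perm_coded_vectors S x N j m (e : 'I_m -> forest_vertex_at n j) :
  set_bij setT [set p | S (existT _ j p)] e ->
  (forall p : forest_vertex_at n j, S (existT _ j p) -> (code p < N)%N) ->
  perm_eq [seq coded_vector x j k | k <- iota 0 N & code_set_at S j k]
    [seq forest_vector x (e k) | k : 'I_m].
Proof.
move=> [eS einj esurj] bd.
have -> : [seq forest_vector x (e k) | k : 'I_m] =
    [seq coded_vector x j k | k <- [seq code (e k) | k : 'I_m]].
  by rewrite -map_comp; apply: eq_map => k /=; rewrite coded_vectorE.
apply/perm_map/uniq_perm.
- by rewrite filter_uniq // iota_uniq.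
- rewrite map_inj_uniq ?enum_uniq // => k l /code_inj kl.
  by apply: einj => //; rewrite inE.
move=> k; rewrite mem_filter mem_iota /= add0n; apply/andP/mapP.
  move=> [/asboolP[p [Sp <-]] _]; have [i _ <-] := esurj p Sp.
  by exists i => //; rewrite mem_enum.
move=> [i _ ->]; have Se : S (existT _ j (e i)) by exact: eS.
by rewrite bd // code_set_atE; split => //; apply/asboolP.
Qed.

Lemma forest_basis_coded S x N j : forest_basis S x ->
  (forall p : forest_vertex_at n j, S (existT _ j p) -> (code p < N)%N) ->
  basis_of fullv [seq coded_vector x j k | k <- iota 0 N & code_set_at S j k].
Proof.
move=> bS bd; have [m [e [be ee]]] := bS j.
by rewrite (perm_basis _ (perm_coded_vectors x be bd)).
Qed.

(** Codes below this bound have at most as many digits as the total dimension, which is the number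
    of vertices of a subforest that gives bases. *)
Definition code_bound : nat := (code_base n ^ \sum_j d j)%N.

Lemma forest_basis_size x j m (e : 'I_m -> forest_vertex_at n j) :
  basis_of (@fullv F 'cV[F]_(d j)) [seq forest_vector x (e k) | k : 'I_m] -> m = d j.
Proof.
move=> /andP[/eqP sp]; rewrite /free sp size_map size_enum_ord dimvf => /eqP <-.
by rewrite /dim /= muln1.
Qed.

(** Let D be the total dimension. A code not below the bound has more than D digits, so its vertex
    and the predecessors of it would give D + 1 distinct vertices of [S], which has only D. *)
Lemma forest_basis_code_bound S x : subforest S -> forest_basis S x ->
  forall j (p : forest_vertex_at n j), S (existT _ j p) -> (code p < code_bound)%N.
Proof.
move=> sS bS j p Sp; rewrite ltnNge; apply/negP => le.
set D := (\sum_j d j)%N in le *.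
have b1 := code_base_gt1 p; have b0 : (0 < code_base n)%N by exact: ltnW.
(* Dividing by the [t]-th power of the base removes the last [t] arrows; as long as [t] is less than
   D, at least one arrow remains. *)
have chain t : (t <= D)%N -> code_set S (code p %/ code_base n ^ t).
  elim: t => [|t IHt] tD; first by rewrite divn1 code_setE; apply/asboolP.
  rewrite expnSr divnMA; apply: code_set_divn => //; first exact/IHt/ltnW.
  rewrite leq_divRL ?expn_gt0 ?b0 // -expnS; apply: leq_trans le.
  by rewrite leq_exp2l.
(* The codes of the vertices of [S] ending in [i]; their concatenation has length D. *)
have /choice[l Hl] : forall i, exists l : seq nat, size l = d i /\
    forall p : forest_vertex_at n i, S (existT _ i p) -> code p \in l.
  move=> i.
  have [m [e [[_ _ esurj] /forest_basis_size md]]] := bS i.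
  exists [seq code (e k) | k : 'I_m]; rewrite size_map size_enum_ord; split=> //.
  by move=> p' /esurj[k _ <-]; apply/map_f; rewrite mem_enum.
pose c t := (code p %/ code_base n ^ t)%N.
have c_lt t t' : (t < t')%N -> (t' <= D)%N -> (c t' < c t)%N.
  move=> tt' t'D; rewrite /c -(subnKC (ltnW tt')) expnD divnMA ltn_Pdiv //.
    by rewrite -(exp1n (t' - t)) ltn_exp2r ?subn_gt0.
  have := chain t (leq_trans (ltnW tt') t'D).
  by move=> /asboolP[i [p' [_ <-]]]; exact: code_gt0.
have uc : uniq [seq c t | t <- iota 0 D.+1].
  rewrite map_inj_in_uniq ?iota_uniq // => t t'.
  rewrite !mem_iota /= !add0n !ltnS => tD t'D e.
  by case: (ltngtP t t') => // /c_lt; rewrite e ltnn; [move/(_ t'D)|move/(_ tD)].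
have /(uniq_leq_size uc) : {subset [seq c t | t <- iota 0 D.+1] <=
    flatten [seq l i | i : Q]}.
  move=> _ /mapP[t + ->]; rewrite mem_iota /= add0n ltnS => /chain.
  move=> /asboolP[i [p' [Sp' p'c]]]; apply/flattenP; exists (l i).
    by apply/map_f; rewrite mem_enum.
  by rewrite /c -p'c; have [_] := Hl i; exact.
rewrite size_map size_iota size_flatten /shape -map_comp sumnE big_map big_enum /=.
by under eq_bigr do rewrite (Hl _).1; rewrite ltnn.
Qed.
End ForestVectors.

(** * Charts and normal forms *)

Section Chart.
Variables (F : fieldType) (Q : quiver) (d n : Q -> nat).
Variables (S : set (forest_vertex n)) (subS : subforest S).
Variable e : forall j, 'I_(d j) -> forest_vertex_at n j.
Hypothesis e_bij : forall j, set_bij setT [set p | S (existT _ j p)] (@e j).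
Implicit Types (x y : pairs F d n).

Let e_in j (k : 'I_(d j)) : S (existT _ j (e k)).
Proof. by have [+ _ _] := e_bij j; exact. Qed.

Let e_inj j : injective (@e j).
Proof. by move=> k l; have [_ + _] := e_bij j; apply; rewrite inE. Qed.

Let e_surj j (p : forest_vertex_at n j) : S (existT _ j p) -> exists k, e k = p.
Proof. by move=> Sp; have [_ _ /(_ p Sp) [k _ <-]] := e_bij j; exists k. Qed.

Definition basis_mx x (j : Q) : 'M[F]_(d j) :=
  \matrix_(r, k) forest_vector x (e k) r 0.

Lemma basis_mxE x j r k : basis_mx x j r k = forest_vector x (e k) r 0.
Proof. by rewrite mxE. Qed.

Lemma forest_basis_unitmx x :
  forest_basis S x <-> forall j, basis_mx x j \in unitmx.
Proof.
split=> [bS j|uB j].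
  have [m [e' [be' ee']]] := bS j; rewrite /basis_mx -basis_of_cols.
  have bd p : S (existT _ j p) -> (code p < (\max_k code (e (j:=j) k)).+1)%N.
    by move=> /e_surj[k <-]; rewrite ltnS leq_bigmax.
  rewrite -(perm_basis _ (perm_coded_vectors x (e_bij j) bd)).
  by rewrite (perm_basis _ (perm_coded_vectors x be' bd)).
by exists (d j), (@e j); split; [exact: e_bij|rewrite basis_of_cols; exact: uB].
Qed.

Definition normal_form x : pairs F d n := [ffun c : coords d n =>
  match c with
  | inl (existT a (r, k)) =>
      (invmx (basis_mx x (tgt a)) *m arrow_mx x a *m basis_mx x (src a)) r k
  | inr (existT q (r, k)) => (invmx (basis_mx x q) *m frame_mx x q) r k
  end].

Lemma arrow_mx_normal_form x a : arrow_mx (normal_form x) a =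
  invmx (basis_mx x (tgt a)) *m arrow_mx x a *m basis_mx x (src a).
Proof. by apply/matrixP => r k; rewrite mxE ffunE. Qed.

Lemma frame_mx_normal_form x q :
  frame_mx (normal_form x) q = invmx (basis_mx x q) *m frame_mx x q.
Proof. by apply/matrixP => r k; rewrite mxE ffunE. Qed.

Lemma base_change_normal_form x : (forall j, basis_mx x j \in unitmx) ->
  base_change x (normal_form x).
Proof.
move=> uB; exists (fun j => invmx (basis_mx x j)); split=> [q|a|q].
- by rewrite unitmx_inv.
- by rewrite arrow_mx_normal_form invmxK.
- exact: frame_mx_normal_form.
Qed.

Lemma basis_mx_mul x y (g : forall j, 'M[F]_(d j)) :
  (forall j (p : forest_vertex_at n j), forest_vector y p = g j *m forest_vector x p) ->
  forall j, basis_mx y j = g j *m basis_mx x j.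
Proof.
move=> H j; apply/matrixP => r k; rewrite basis_mxE H [LHS]mxE [RHS]mxE.
by apply: eq_bigr => i _; rewrite basis_mxE.
Qed.

(** The basis matrices are multiplied by the same [g], which cancels; so on the chart the normal
    form depends only on the class. *)
Lemma normal_form_base_change x y : base_change x y ->
  (forall j, basis_mx x j \in unitmx) -> normal_form y = normal_form x.
Proof.
move=> [g [gU ga gf]] uB.
have Bg := basis_mx_mul (base_change_vector gU ga gf).
have iB j : invmx (basis_mx y j) = invmx (basis_mx x j) *m invmx (g j).
  have uBy : basis_mx y j \in unitmx by rewrite Bg unitmx_mul gU uB.
  apply: (can_inj (mulKmx uBy)); rewrite mulmxV // Bg -mulmxA (mulmxA (basis_mx x j)).
  by rewrite mulmxV // mul1mx mulmxV.
apply/ffunP => -[[a [r k]]|[q [r k]]]; rewrite !ffunE.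
  by rewrite iB ga Bg -!mulmxA !(mulKmx (gU _)).
by rewrite iB gf -!mulmxA (mulKmx (gU _)).
Qed.

Lemma basis_mx_normal_form x : (forall j, basis_mx x j \in unitmx) ->
  forall j, basis_mx (normal_form x) j = 1%:M.
Proof.
move=> uB j; rewrite (@basis_mx_mul x _ (fun j => invmx (basis_mx x j))) ?mulVmx //.
apply: base_change_vector => [q|a|q].
- by rewrite unitmx_inv.
- by rewrite arrow_mx_normal_form invmxK.
- exact: frame_mx_normal_form.
Qed.

(* The entry of a representation in row r of the column belonging to the forest
   vertex p is the coefficient of [e r] in the expansion of p; in normal form it is
   arbitrary if p is a corner of S greater than [e r], and it is prescribed
   otherwise. *)
Definition free_at j (p : forest_vertex_at n j) (r : 'I_(d j)) : bool :=
  ~~ `[< S (existT _ j p) >] && (code (e r) < code p)%N.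

Definition free_coord (c : coords d n) : bool :=
  match c with
  | inl (existT a (r, k)) => free_at (child_vertex (e k)) r
  | inr (existT q (r, i)) => free_at (root_vertex i) r
  end.

(** For [p] in [S] this is a standard basis vector, at the position of [p] in [e]; for [p] outside
    [S] it is 0. *)
Definition fixed_at j (p : forest_vertex_at n j) (r : 'I_(d j)) : F :=
  `[< e r = p >]%:R.

Definition fixed_value (c : coords d n) : F :=
  match c with
  | inl (existT a (r, k)) => fixed_at (child_vertex (e k)) r
  | inr (existT q (r, i)) => fixed_at (root_vertex i) r
  end.

Definition normal x : Prop :=
  forall c, ~~ free_coord c -> (x : {ffun coords d n -> F}) c = fixed_value c.

Lemma fixed_at0 j (p : forest_vertex_at n j) (r : 'I_(d j)) :
  e r <> p -> fixed_at p r = 0.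
Proof. by rewrite /fixed_at => ne; rewrite asboolF. Qed.

Lemma normal_root x q (i : 'I_(n q)) (r : 'I_(d q)) : normal x ->
  ~~ free_at (root_vertex i) r ->
  forest_vector x (root_vertex i) r 0 = fixed_at (root_vertex i) r.
Proof.
move=> nx /(nx (inr (existT _ q (r, i)))) /= <-.
by rewrite forest_vector_root -colE !mxE.
Qed.

Lemma normal_arrow x a (r : 'I_(d (tgt a))) (k : 'I_(d (src a))) : normal x ->
  ~~ free_at (child_vertex (e k)) r ->
  arrow_mx x a r k = fixed_at (child_vertex (e k)) r.
Proof.
move=> nx /(nx (inl (existT _ a (r, k)))) /= <-.
by rewrite mxE.
Qed.

Lemma not_free_at_in j (p : forest_vertex_at n j) (r : 'I_(d j)) :
  S (existT _ j p) -> ~~ free_at p r.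
Proof. by move=> Sp; rewrite /free_at asboolT. Qed.

Lemma not_free_at_leq j (p : forest_vertex_at n j) (r : 'I_(d j)) :
  (code p <= code (e r))%N -> ~~ free_at p r.
Proof. by move=> le; rewrite /free_at ltnNge le andbF. Qed.

(** The parent of a vertex of [S] is some [e k], whose vector is the [k]-th standard vector by
    induction; the vector of the child is then column [k] of the arrow, which is entirely
    prescribed. *)
Lemma normal_vector x j (p : forest_vertex_at n j) (r : 'I_(d j)) : normal x ->
  S (existT _ j p) -> forest_vector x p r 0 = fixed_at p r.
Proof.
move=> nx; elim/forest_ind: j / p r => [q i r Sp|a p IHp r Sp].
  exact/normal_root/not_free_at_in.
have [k ek] : exists k, e k = p by apply/e_surj/((subforestP S).1 subS).
rewrite forest_vector_child mxE (bigD1 k) //= big1 => [|l lk].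
  rewrite IHp ?addr0 -?ek; last exact: e_in.
  rewrite /fixed_at (asboolT (erefl (e k))) mulr1 normal_arrow //.
  by apply: not_free_at_in; rewrite ek.
rewrite IHp -?ek; last exact: e_in.
by rewrite fixed_at0 ?mulr0 // => /e_inj ekl; rewrite ekl eqxx in lk.
Qed.

Lemma normal_basis_mx x j : normal x -> basis_mx x j = 1%:M.
Proof.
move=> nx; apply/matrixP => r k; rewrite basis_mxE [RHS]mxE normal_vector // /fixed_at.
congr (_%:R); congr nat_of_bool; apply/asboolP/eqP => [/e_inj//|->//].
Qed.

(** Triangularity: by induction the parent involves only those [e k] that do not exceed it. Their
    children do not exceed the given child, and normality makes the columns of these children vanish
    at all greater [e r]. *)
Lemma normal_vector_upper x j (p : forest_vertex_at n j) (r : 'I_(d j)) : normal x ->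
  (code p < code (e r))%N -> forest_vector x p r 0 = 0.
Proof.
move=> nx; elim/forest_ind: j / p r => [q i r lt|a p IHp r lt].
  rewrite normal_root //; last exact/not_free_at_leq/ltnW.
  by apply: fixed_at0 => er; rewrite er ltnn in lt.
rewrite forest_vector_child mxE big1 // => k _.
have [kp|pk] := leqP (code (e k)) (code p); last by rewrite IHp ?mulr0.
have {}lt : (code (child_vertex (e k)) < code (e r))%N.
  apply: leq_ltn_trans lt; move: kp; rewrite leq_eqVlt => /predU1P[/code_inj->//|lt].
  exact/ltnW/code_child_mono.
rewrite normal_arrow ?fixed_at0 ?mul0r //; last exact/not_free_at_leq/ltnW.
by move=> er; rewrite er ltnn in lt.
Qed.

Lemma coord_span_eq0 (m : nat) (r : 'I_m) (X : seq 'cV[F]_m) v :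
  (forall w, w \in X -> w r 0 = 0) -> v \in <<X>>%VS -> v r 0 = 0.
Proof.
move=> H; pose f := linfun (mulmx (delta_mx 0 r) : 'cV[F]_m -> 'cV[F]_1).
have fE w : f w 0 0 = w r 0 by rewrite lfunE /= -rowE mxE.
suff /subvP /[apply] : (<<X>> <= lker f)%VS by rewrite memv_ker -fE => /eqP ->; rewrite mxE.
apply/span_subvP => w /H wr; rewrite memv_ker; apply/eqP/matrixP => z z'.
by rewrite (ord1 z) (ord1 z') fE wr mxE.
Qed.

Lemma coded_coord_eq0 x j (r : 'I_(d j)) k v :
  (forall p : forest_vertex_at n j, (code p < k)%N -> forest_vector x p r 0 = 0) ->
  v \in prefix_span (coded_vector x j) k -> v r 0 = 0.
Proof.
move=> H; apply: coord_span_eq0 => _ /mapP[i + ->]; rewrite mem_iota => /= ik.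
have [[p pi]|nop] := pselect (exists p : forest_vertex_at n j, code p = i).
  by rewrite -pi coded_vectorE H // pi.
by rewrite coded_vector_notin // mxE.
Qed.

(** A vertex outside [S] is expanded in the standard basis, that is, in vectors of [S], and
    triangularity leaves only smaller ones. For [e r], all smaller vectors have [r]-th coordinate 0
    while its own is 1. *)
Lemma normal_greedy x : normal x -> greedy_forest x = S.
Proof.
move=> nx; apply/seteqP; split=> -[j p].
  apply: contraPP => nSp; apply/greedy_forestN.
  have sE (c : F) (v : 'cV[F]_(d j)) i z : (c *: v) i z = c * v i z by rewrite mxE.
  have -> : forest_vector x p = \sum_r forest_vector x p r 0 *: forest_vector x (e r).
    apply/matrixP => r z; rewrite (ord1 z) summxE (bigD1 r) //= big1 => [|l lr].
      by rewrite sE (normal_vector r nx (e_in r)) /fixed_at asboolT // mulr1 addr0.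
    rewrite sE (normal_vector r nx (e_in l)) fixed_at0 ?mulr0 // => /e_inj rl.
    by rewrite rl eqxx in lr.
  apply: memv_suml => r _.
  have [lt|] := ltnP (code (e r)) (code p).
    by apply: memvZ; rewrite -coded_vectorE; exact: mem_prefix_span.
  rewrite leq_eqVlt => /predU1P[/code_inj pr|lt]; last first.
    by rewrite normal_vector_upper // scale0r mem0v.
  by case: nSp; rewrite pr.
move=> /e_surj[r <-]; apply: contrapT => /greedy_forestN.
move=> /(@coded_coord_eq0 _ _ r)/eqP; rewrite (normal_vector r nx (e_in r)) /fixed_at asboolT //.
by rewrite oner_eq0 => /(_ (fun p => normal_vector_upper nx)).
Qed.

(** The normal form has the same greedy subforest. There a vertex outside [S] lies in the span of
    smaller greedy vectors, which are standard basis vectors, so its other coordinates vanish. *)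
Lemma greedy_normal x : (forall j, basis_mx x j \in unitmx) -> greedy_forest x = S ->
  normal (normal_form x).
Proof.
move=> uB; rewrite (base_change_greedy (base_change_normal_form uB)).
have := basis_mx_normal_form uB; move: (normal_form x) => {uB}y By gS.
have ye j (r k : 'I_(d j)) : forest_vector y (e k) r 0 = (r == k)%:R.
  by have /matrixP/(_ r k) := By j; rewrite basis_mxE [RHS]mxE.
(* Proved for all vertices at once; the entries of arrows and framings are the cases of children of
   [e k] and of roots. *)
have ycol j (p : forest_vertex_at n j) r : ~~ free_at p r ->
    forest_vector y p r 0 = fixed_at p r.
  have [/e_surj[k <-] _|nSp] := pselect (S (existT _ j p)).
    rewrite ye /fixed_at; congr (_%:R); congr nat_of_bool.
    by apply/eqP/asboolP => [->//|/e_inj].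
  rewrite /free_at asboolF //= -leqNgt => pr.
  rewrite fixed_at0; last by move=> er; case: nSp; rewrite -er.
  have : ~ greedy_forest y (existT _ j p) by rewrite gS.
  move=> /greedy_forestN; rewrite -span_greedy.
  apply: coord_span_eq0 => _ /mapP[i + ->]; rewrite mem_filter mem_iota /= add0n.
  move=> /andP[gi ip].
  have [[p' pi]|nop] := pselect (exists p : forest_vertex_at n j, code p = i); last first.
    by rewrite coded_vector_notin // mxE.
  have /e_surj[k ek] : S (existT _ j p') by rewrite -gS /greedy_forest /= pi.
  rewrite -pi coded_vectorE -ek ye; case: eqP => // rk.
  by move: (leq_trans ip pr); rewrite rk ek pi ltnn.
move=> [[a [r k]]|[q [r i]]] /= nf.
  rewrite -ycol // forest_vector_child.
  have -> : forest_vector y (e k) = delta_mx k 0.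
    by apply/matrixP => l z; rewrite (ord1 z) ye mxE andbT.
  by rewrite -colE !mxE.
by rewrite -ycol // forest_vector_root -colE !mxE.
Qed.


Lemma normal_form_id x : (forall j, basis_mx x j = 1%:M) -> normal_form x = x.
Proof.
move=> B1; apply/ffunP => -[[a [r k]]|[q [r i]]]; rewrite ffunE !B1 invmx1.
  by rewrite mul1mx mulmx1 mxE.
by rewrite mul1mx mxE.
Qed.

Definition cell_dim : nat := #|[pred c | free_coord c]|.

(** Parametrizes the normal pairs by their free entries: the search fails exactly at the coordinates
    that are not free. *)
Definition of_coords (y : affine F 'I_cell_dim) : pairs F d n :=
  [ffun c : coords d n =>
    if [pick t : 'I_cell_dim | enum_val t == c] is Some t
    then (y : {ffun 'I_cell_dim -> F}) t else fixed_value c].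

Definition cell_coords x : affine F 'I_cell_dim :=
  [ffun t : 'I_cell_dim => (normal_form x : {ffun coords d n -> F}) (enum_val t)].

Lemma of_coords_normal (y : affine F 'I_cell_dim) : normal (of_coords y).
Proof.
move=> c nc; rewrite ffunE; case: pickP => // t /eqP tc.
by have := enum_valP t; rewrite tc inE (negPf nc).
Qed.

Lemma of_coordsK (y : affine F 'I_cell_dim) : cell_coords (of_coords y) = y.
Proof.
apply/ffunP => t; rewrite ffunE normal_form_id => [|j]; last first.
  exact/normal_basis_mx/of_coords_normal.
rewrite ffunE; case: pickP => [t' /eqP /enum_val_inj -> //|/(_ t)].
by rewrite eqxx.
Qed.

Lemma cell_coordsK x : normal (normal_form x) -> of_coords (cell_coords x) = normal_form x.
Proof.
move=> nx; apply/ffunP => c; rewrite ffunE; case: pickP => [t /eqP <-|nt].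
  by rewrite ffunE.
rewrite -nx //; apply/negP => fc; have fc' : c \in [pred c | free_coord c] by [].
by have := nt (enum_rank_in fc' c); rewrite enum_rankK_in // eqxx.
Qed.

Lemma of_coords_stable (y : affine F 'I_cell_dim) : stable (of_coords y).
Proof.
apply: (@forest_basis_stable _ _ _ _ S); apply/forest_basis_unitmx => j.
by rewrite normal_basis_mx ?unitmx1 //; exact: of_coords_normal.
Qed.

(** * Regularity of the normal form and of the parametrization *)

Let sP : function_sheaf (pairs F d n) := affine_function_sheaf F (coords d n).

Lemma regular_arrow_mx (a : arrow Q) :
  @regular_mx F (pairs F d n) _ _ setT (fun x => arrow_mx x a).
Proof.
move=> r k; apply: (eq_regular sP openT _ (regular_coord
  (inl (existT (fun a => 'I_(d (tgt a)) * 'I_(d (src a)))%type a (r, k))) openT)).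
by move=> x _; rewrite mxE.
Qed.

Lemma regular_frame_mx (q : Q) :
  @regular_mx F (pairs F d n) _ _ setT (fun x => frame_mx x q).
Proof.
move=> r k; apply: (eq_regular sP openT _ (regular_coord
  (inr (existT (fun q => 'I_(d q) * 'I_(n q))%type q (r, k))) openT)).
by move=> x _; rewrite mxE.
Qed.

Lemma regular_forest_vector (j : Q) (p : forest_vertex_at n j) :
  @regular_mx F (pairs F d n) _ _ setT (fun x => forest_vector x p).
Proof.
elim/forest_ind: j / p => [q i|a p IHp] r z.
  apply: (eq_regular sP openT _ (regular_frame_mx r i)) => x _.
  by rewrite forest_vector_root (ord1 z) -colE [RHS]mxE.
apply: (eq_regular sP openT _ (regular_mulmx sP openT (@regular_arrow_mx a) IHp r z)).
by move=> x _; rewrite forest_vector_child.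
Qed.

Lemma regular_basis_mx (j : Q) :
  @regular_mx F (pairs F d n) _ _ setT (fun x => basis_mx x j).
Proof.
move=> r k; apply: (eq_regular sP openT _ (regular_forest_vector (e k) r 0)).
by move=> x _; rewrite basis_mxE.
Qed.

Definition basis_locus : set (pairs F d n) :=
  [set x | forall j, basis_mx x j \in unitmx].

(** It is the non-vanishing locus of the product of the determinants of the basis matrices. *)
Lemma basis_locus_open : open basis_locus.
Proof.
have rd : regular setT (fun x : pairs F d n => \prod_j \det (basis_mx x j)).
  by apply: (regular_prod sP) => [|j];
    [exact: openT|exact: (regular_det sP openT (@regular_basis_mx j))].
have := open_regular_neq0 sP openT rd; rewrite setTI.
have -> // : [set x : pairs F d n | \prod_j \det (basis_mx x j) != 0] = basis_locus.
apply/seteqP; split=> x /= => [/prodf_neq0 H j|H].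
  by rewrite unitmxE unitfE H.
by apply/prodf_neq0 => j _; rewrite -unitfE -unitmxE.
Qed.

Lemma regular_normal_form (c : coords d n) :
  regular basis_locus (fun x => (normal_form x : {ffun coords d n -> F}) c).
Proof.
have oB := basis_locus_open.
have sub m k (A : pairs F d n -> 'M[F]_(m, k)) :
    regular_mx setT A -> regular_mx basis_locus A.
  by move=> rA r z; apply: (regular_sub sP openT oB _ (rA r z)).
have rV j : @regular_mx F (pairs F d n) _ _ basis_locus (fun x => invmx (basis_mx x j)).
  by apply: (regular_invmx sP oB (sub _ _ _ (@regular_basis_mx j))) => x; exact.
case: c => [[a [r k]]|[q [r k]]].
  apply: (eq_regular sP oB _ (regular_mulmx sP oB (regular_mulmx sP oB (rV (tgt a))
    (sub _ _ _ (@regular_arrow_mx a))) (sub _ _ _ (@regular_basis_mx (src a))) r k)).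
  by move=> x _; rewrite ffunE.
apply: (eq_regular sP oB _ (regular_mulmx sP oB (rV q)
  (sub _ _ _ (@regular_frame_mx q)) r k)).
by move=> x _; rewrite ffunE.
Qed.

Lemma of_coords_morphism :
  @morphism F (affine_space F 'I_cell_dim) (pairs F d n) of_coords.
Proof.
have sA := affine_function_sheaf F 'I_cell_dim.
apply: (morphism_to_affine sA) => c.
case: (pickP (fun t : 'I_cell_dim => enum_val t == c)) => [t /eqP tc|nt].
  apply: (eq_regular sA openT _ (regular_coord t openT)) => x _.
  rewrite ffunE; case: pickP => [t' /eqP|/(_ t)]; last by rewrite tc eqxx.
  by rewrite -tc => /enum_val_inj ->.
apply: (eq_regular sA openT _ (regular_cst sA (fixed_value c) openT)) => x _.
by rewrite ffunE; case: pickP => // t; rewrite nt.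
Qed.

End Chart.

(** * Cells of the Hilbert scheme *)

Section HilbertScheme.
Variables (F : fieldType) (Q : quiver) (d n : Q -> nat).
Let H := hilbert F d n.

Let sStable : function_sheaf (stable_pairs F d n) :=
  subspace_function_sheaf (affine_function_sheaf F (coords d n)) (@stable F Q d n).

Let sH : function_sheaf H := quotient_function_sheaf sStable (same_class_equiv F d n).

(** Read off a chosen representative; [greedy_cell_class] shows independence of the choice. *)
Definition greedy_cell (h : H) : set (forest_vertex n) :=
  greedy_forest (set_val (repr h)).

Lemma base_change_repr (x : stable_pairs F d n) :
  base_change (set_val x) (set_val (repr (class_of x))).
Proof.
have : same_class_equiv F d n x (repr (class_of x)) by apply/eqmodP; rewrite reprK.
by move/asboolP.
Qed.


Lemma class_of_repr (h : H) : class_of (repr h) = h.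
Proof. exact: reprK. Qed.

Lemma base_change_sym (x y : pairs F d n) : base_change x y -> base_change y x.
Proof.
move=> [g [gU ga gf]]; exists (fun q => invmx (g q)); split=> [q|a|q].
- by rewrite unitmx_inv.
- by rewrite ga invmxK -!mulmxA mulVmx// mulmx1 mulmxA mulVmx// mul1mx.
- by rewrite gf mulmxA mulVmx// mul1mx.
Qed.

Lemma greedy_cell_class (x : stable_pairs F d n) :
  greedy_cell (class_of x) = greedy_forest (set_val x).
Proof. exact/esym/base_change_greedy/base_change_repr. Qed.

Lemma forest_basis_base_change S (x y : pairs F d n) : base_change x y ->
  forest_basis S x -> forest_basis S y.
Proof.
move=> [g [gU ga gf]] bS j; have [m [e [be ee]]] := bS j.
(* A basis at [j] has [d j] elements, so the family is a square matrix and [basis_of_cols]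
   applies. *)
exists m, e; split => //; have md := forest_basis_size ee; subst m.
have := ee; rewrite !basis_of_cols => uB.
have -> : \matrix_(r, k) forest_vector y (e k) r 0 =
    g j *m \matrix_(r, k) forest_vector x (e k) r 0; last by rewrite unitmx_mul gU.
apply/matrixP => r k; rewrite [LHS]mxE (base_change_vector gU ga gf) [LHS]mxE [RHS]mxE.
by apply: eq_bigr => i _; congr (_ * _); rewrite [RHS]mxE.
Qed.

Lemma chart_class S (x : stable_pairs F d n) :
  chart (d := d) S (class_of x) <-> forest_basis S (set_val x).
Proof.
split=> [[x' /= bS xx']|bS]; last by exists x.
apply: forest_basis_base_change bS.
have /eqmodP : \pi_({eq_quot same_class_equiv F d n}) x' = \pi x by [].
by move/asboolP.
Qed.

(** * The chart and the cell of a fixed subforest *)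

Section Cell.
Variables (S : set (forest_vertex n)) (e : forall j, 'I_(d j) -> forest_vertex_at n j).
Hypothesis e_bij : forall j, set_bij setT [set p | S (existT _ j p)] (@e j).

Lemma chart_basis_locus : @class_of F Q d n @^-1` (chart S) = set_val @^-1` (basis_locus e).
Proof.
apply/seteqP; split=> x /=; first by move/chart_class/(forest_basis_unitmx e_bij).
by move/(forest_basis_unitmx e_bij)/chart_class.
Qed.

Lemma chart_open : open (chart S : set H).
Proof.
apply/open_quotientP; rewrite [X in open X]chart_basis_locus.
by apply/open_subspace_ofP; exists (basis_locus e) => //; exact: basis_locus_open.
Qed.

(** The representative is an arbitrary choice, but the normal form does not depend on it, so the
    pullback to stable pairs is the normal form of the pair itself. *)
Lemma regular_normal_form_chart (c : coords d n) : @regular F H (chart S)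
  (fun h => (normal_form e (set_val (repr h)) : {ffun coords d n -> F}) c).
Proof.
have oB := basis_locus_open F e.
have := @regular_set_val _ _ (@stable F Q d n) _ _ (@regular_normal_form F Q d n e c) oB.
rewrite -chart_basis_locus => r.
apply: (eq_regular sStable _ _ r); first exact: chart_open.
move=> x; rewrite /= => /chart_class/(forest_basis_unitmx e_bij) uB.
by rewrite (normal_form_base_change (base_change_repr x) uB).
Qed.

Hypothesis subS : subforest S.

Let Z : set H := [set h | greedy_cell h = S].

Let Z_chart : Z `<=` chart S.
Proof.
move=> h <-; rewrite -(class_of_repr h); apply/chart_class.
rewrite greedy_cell_class; apply: greedy_forest_basis.
exact: set_valP.
Qed.

Let stable_point (y : affine F 'I_(cell_dim S e)) : stable_pairs F d n :=
  exist _ (of_coords y) (mem_set (@of_coords_stable F Q d n S subS e e_bij y)).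

Let cell_pointP y : Z (class_of (stable_point y)).
Proof.
rewrite /Z /= greedy_cell_class.
exact: (normal_greedy subS e_bij (of_coords_normal _)).
Qed.

(** One map reads off the free entries of the normal form, the other sends free entries to the class
    of the normal pair they define. They are inverse because on the cell the normal form is a normal
    pair, and a normal pair is its own normal form. *)
Lemma cell_isomorphic :
  isomorphic (subspace_of Z) (affine_space F 'I_(cell_dim S e)).
Proof.
exists (fun z => cell_coords S e (set_val (repr (set_val z)))).
exists (fun y => exist _ (class_of (stable_point y)) (mem_set (cell_pointP y))).
split.
- move=> [h hZ]; apply: val_inj => /=; have Zh := set_mem hZ.
  have uB : forall j, basis_mx e (set_val (repr h)) j \in unitmx.
    by apply/(forest_basis_unitmx e_bij)/chart_class; rewrite class_of_repr; exact: Z_chart.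
  rewrite -[RHS]class_of_repr; apply/eqmodP/asboolP.
  change (base_change (of_coords (cell_coords S e (set_val (repr h))))
            (set_val (repr h))).
  rewrite (cell_coordsK (greedy_normal e_bij uB Zh)).
  exact/base_change_sym/base_change_normal_form.
- move=> y /=; rewrite -[RHS](of_coordsK subS e_bij).
  change (cell_coords S e (set_val (repr (class_of (stable_point y)))) =
          cell_coords S e (of_coords y)).
  rewrite /cell_coords (normal_form_base_change (base_change_repr (stable_point y))) // => j.
  by rewrite (normal_basis_mx subS e_bij) ?unitmx1 //; exact: of_coords_normal.
- apply: morphism_to_affine; first exact: subspace_function_sheaf.
  move=> t; have := regular_set_val (Z := Z) (regular_normal_form_chart (enum_val t)) chart_open.
  (* The cell lies in the chart, so regularity on the chart gives regularity on the whole cell. *)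
  have -> : (set_val : subspace_of Z -> H) @^-1` (chart S) = setT.
    by apply/seteqP; split => // -[h hZ] _; exact/Z_chart/set_mem.
  apply: (eq_regular (subspace_function_sheaf sH Z) openT) => z _.
  by rewrite ffunE.
- have sA := affine_function_sheaf F 'I_(cell_dim S e).
  apply: (morphism_to_subspace sA).
  have : @morphism F (affine_space F 'I_(cell_dim S e)) (stable_pairs F d n) stable_point.
    by apply: (morphism_to_subspace sA); exact: of_coords_morphism.
  by move=> /morphism_comp; apply; exact: (morphism_pi (same_class_equiv F d n)).
Qed.

End Cell.

(** * Weights of subforests and the cell decomposition *)

Lemma greedy_cell_Phi (h : H) : Phi F d n (greedy_cell h) /\ chart (greedy_cell h) h.
Proof.
have ch : chart (greedy_cell h) h.
  rewrite -[X in chart _ X](class_of_repr h); apply/chart_class/greedy_forest_basis.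
  exact: set_valP.
by split=> //; split; [exact: greedy_subforest|exists h].
Qed.

(** Turns the lexicographic order on [Phi] into numbers; by [Phi_code_bound], cutting off at
    [code_bound] loses no vertex of a member of [Phi]. *)
Definition weight (S : set (forest_vertex n)) : nat :=
  lexweight (code_set S) (code_bound d n).

Lemma Phi_code_bound S j (p : forest_vertex_at n j) :
  Phi F d n S -> S (existT _ j p) -> (code p < code_bound d n)%N.
Proof.
by move=> [subS [_ [x bS _]]]; exact: (forest_basis_code_bound subS bS).
Qed.

Lemma weight_inj S S' : Phi F d n S -> Phi F d n S' -> weight S = weight S' -> S = S'.
Proof.
move=> PS PS' /lexweight_inj e.
have sub T T' : Phi F d n T -> (forall k, (k < code_bound d n)%N ->
    code_set T k = code_set T' k) -> T `<=` T'.
  move=> PT eT [j p] Tp; have /eT := Phi_code_bound PT Tp.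
  by rewrite !code_setE asboolT // => /esym/asboolP.
by apply/seteqP; split; apply: sub => // k /e.
Qed.

(* At the first vertex p where a basis S and the greedy basis differ, p is greedy: being in
   S, it is independent of the smaller greedy vertices, which all belong to S. *)
Lemma weight_greedy S (h : H) : Phi F d n S -> chart S h ->
  (weight (greedy_cell h) <= weight S)%N.
Proof.
move=> PS; rewrite -[X in chart _ X](class_of_repr h) => /chart_class bS.
apply: leq_lexweight => k kN agree /asboolP[j [p [Sp pk]]]; subst k.
rewrite code_setE; apply/asboolP.
have bd (p' : forest_vertex_at n j) : S (existT _ j p') -> (code p' < code_bound d n)%N.
  exact: Phi_code_bound.
have /basis_free fS := forest_basis_coded bS bd.
apply: (greedy_of_free fS kN) => [i ip|]; last by rewrite code_set_atE asboolT.
have [[p' pi]|nop] := pselect (exists p : forest_vertex_at n j, code p = i).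
  have := agree i ip; rewrite -pi !code_setE code_set_atE => <-.
  by apply/idP/asboolP.
rewrite /greedy coded_vector_notin // mem0v /=.
by apply/esym/asboolPn => -[p' [_ pi]]; apply: nop; exists p'.
Qed.

Lemma hilbert_cell_decomposition : has_cell_decomposition H (Phi F d n).
Proof.
(* A nonempty chart forces [S] to have exactly [d j] vertices ending in [j]. *)
have enumS S : Phi F d n S -> exists e : forall j, 'I_(d j) -> forest_vertex_at n j,
    forall j, set_bij setT [set p | S (existT _ j p)] (e j).
  move=> [_ [_ [x bS _]]].
  have ej j : exists e : 'I_(d j) -> forest_vertex_at n j,
      set_bij setT [set p | S (existT _ j p)] e.
    have [m [e [be /forest_basis_size md]]] := bS j.
    by rewrite -md; exists e.
  by exists (fun j => projT1 (cid (ej j))) => j; case: (cid _).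
(* A weight has [code_bound] binary digits, which bounds the number of strata; those whose index is
   not the weight of a member of [Phi] are empty. *)
apply: (@cell_decomposition_of_cover _ _ sH _ _ weight (2 ^ code_bound d n)%N
  (fun S => chart S) greedy_cell).
- by move=> S _; exact: lexweight_lt.
- exact: weight_inj.
- by move=> S /enumS[e e_bij]; exact: chart_open e_bij.
- exact: greedy_cell_Phi.
- exact: weight_greedy.
- move=> S PS; have [e e_bij] := enumS S PS; exists (cell_dim S e).
  exact: cell_isomorphic e_bij PS.1.
Qed.

End HilbertScheme.

Theorem corollary7p8 (R : realType) (Q : quiver) (d n : Q -> nat) :
  has_cell_decomposition (hilbert R[i] d n) (Phi R[i] d n).
Proof. exact: hilbert_cell_decomposition. Qed.
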